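(* Let $A\in\mathbb{R}^{l\times m}$, $B\in\mathbb{R}^{n\times m}$ with $C=\ker A\cap\mathbb{R}^m_>\neq\emptyset$ and $d_P=d$, and let $\overline P$, $T$, $D$ and $F\colon\mathbb{R}^{d_P}\to\mathbb{R}^d_>$ be as defined in the context. The map $F$ is a diffeomorphism if (i) $\operatorname{sign}(D^\perp)\cap\operatorname{sign}(T)=\{0\}$, and (ii) for every nonempty proper face $f$ of $\overline P$ with corresponding sign vector $\tau_f\in\{0,+\}^m$, $\tau_f\notin\operatorname{sign}(D^\perp)$.
   Context: Notation: $\mathbb{R}_>$ are the positive reals, $\mathbb{R}_\ge$ the nonnegative reals, $1_m\in\mathbb{R}^m$ is the all-ones vector. For $x\in\mathbb{R}^m_>$ and $y\in\mathbb{R}^m$, $x^y=\prod_i x_i^{y_i}$; for a matrix $Y=(y^1,\ldots,y^r)\in\mathbb{R}^{m\times r}$ with columns $y^j$, $x^Y\in\mathbb{R}^r_>$ has components $(x^Y)_j=x^{y^j}$. For $x\in\mathbb{R}^m$, $\operatorname{sign}(x)\in\{-,0,+\}^m$ is obtained by applying the sign function componentwise, and $\operatorname{sign}(S)=\{\operatorname{sign}(x)\mid x\in S\}$ for $S\subseteq\mathbb{R}^m$. Coefficient polytope: $P=C\cap\Delta$ with $C=\ker A\cap\mathbb{R}^m_>$ (assumed nonempty) and $\Delta=\{y\in\mathbb{R}^m_\ge\mid 1_m\cdot y=1\}$; $d_P=\dim P$. $P$ is relatively open; its closure $\overline P$ is a polytope with vertices $v^1,\ldots,v^{n_P}\in\mathbb{R}^m$.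 Subspaces: $\mathcal{A}=\begin{pmatrix}A\\1_m^{\mathsf T}\end{pmatrix}$, $T=\ker\mathcal{A}$ (of dimension $d_P$), $T=\operatorname{im}G$ with $G\in\mathbb{R}^{m\times d_P}$ having orthonormal columns. $\mathcal{B}=\begin{pmatrix}B\\1_m^{\mathsf T}\end{pmatrix}$, $D=\ker\mathcal{B}$, $d=\dim D$, $D=\operatorname{im}H$ with basis matrix $H\in\mathbb{R}^{m\times d}$. Standing assumption: $d_P=d$. Parametrization $p\colon\mathbb{R}^{d_P}\to P$ (a real analytic isomorphism) and map $F$: \[ p(\xi)=\frac{\sum_{k=1}^{n_P}\mathrm{e}^{v^k\cdot G\xi}\,v^k}{\sum_{k=1}^{n_P}\mathrm{e}^{v^k\cdot G\xi}},\qquad F\colon\mathbb{R}^{d_P}\to\mathbb{R}^d_>,\quad F(\xi)=p(\xi)^H . \] Diffeomorphism means a bijective $C^1$ map with $C^1$ inverse. For a face $f$ of $\overline P$, the sign vector $\tau_f\in\{0,+\}^m$ is defined by $(\tau_f)_i=+$ if $x_i=0$ for all $x\in f$, and $(\tau_f)_i=0$ otherwise. A proper face is a face different from $\overline P$. *)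

(* Defs.v *)
(* Vectors of R^m are column vectors 'cV[R]_m. *)
From HB Require Import structures.
From mathcomp Require Import all_boot all_order all_algebra.
From mathcomp Require Import all_classical all_reals all_analysis.

Set Implicit Arguments.
Unset Strict Implicit.
Unset Printing Implicit Defensive.

Import Order.TTheory GRing.Theory Num.Theory numFieldNormedType.Exports.

Local Open Scope classical_set_scope.
Local Open Scope ring_scope.

Section Defs.
Context {R : realType}.

Section LinearAlgebra.
Variable m : nat.
Implicit Types x y : 'cV[R]_m.

Definition dot x y : R := \sum_i x i 0 * y i 0.

Definition mxKer k (A : 'M[R]_(k, m)) : {vspace 'cV[R]_m} :=
  lker (linfun (fun x : 'cV[R]_m => A *m x)).

Definition mxIm k (G : 'M[R]_(m, k)) : {vspace 'cV[R]_m} :=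
  limg (linfun (fun x : 'cV[R]_k => G *m x)).

Definition orthogonal_complement (U : {vspace 'cV[R]_m}) : set 'cV[R]_m :=
  [set y | forall x, x \in U -> dot y x = 0].

(* The sign symbols -, 0, + are encoded as the integers -1, 0, 1. *)
Definition sign_vector x : 'cV[int]_m := \col_i sgz (x i 0).

Definition sign_set (S : set 'cV[R]_m) : set 'cV[int]_m := sign_vector @` S.

Definition positive_orthant : set 'cV[R]_m := [set x | forall i, 0 < x i 0].

Definition nonneg_orthant : set 'cV[R]_m := [set x | forall i, 0 <= x i 0].

(* The dimension of the affine hull of S; in particular S is nonempty. *)
Definition has_dim (S : set 'cV[R]_m) (k : nat) : Prop :=
  exists2 x0, S x0 &
  exists U : {vspace 'cV[R]_m},
    [/\ forall x, S x -> x - x0 \in U,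
        forall V : {vspace 'cV[R]_m},
          (forall x, S x -> x - x0 \in V) -> (U <= V)%VS
      & \dim U = k].

(* Faces are cut out by valid inequalities; the empty set and Q itself are
   obtained from c = 0. *)
Definition is_face (Q f : set 'cV[R]_m) : Prop :=
  exists c b, (forall x, Q x -> dot c x <= b) /\
              f = [set x | Q x /\ dot c x = b].

Definition is_vertex (Q : set 'cV[R]_m) x : Prop := is_face Q [set x].

Definition face_sign (f : set 'cV[R]_m) : 'cV[int]_m :=
  \col_i (if `[< forall x, f x -> x i 0 = 0 >] then 1 else 0).

End LinearAlgebra.

Section CoefficientPolytope.
Variables (l m : nat) (A : 'M[R]_(l, m)).

Definition add_ones_row : 'M[R]_(l + 1, m) := col_mx A (const_mx 1).

Definition coef_cone : set 'cV[R]_m :=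
  [set` mxKer A] `&` @positive_orthant m.

Definition simplex : set 'cV[R]_m :=
  @nonneg_orthant m `&` [set y | dot (const_mx 1) y = 1].

Definition coef_polytope : set 'cV[R]_m := coef_cone `&` simplex.

Definition closed_coef_polytope : set 'cV[R]_m := closure coef_polytope.

End CoefficientPolytope.

(* x^Y, meant for x in the positive orthant; column j of Y is the exponent
   y^j. *)
Definition monomials m r (x : 'cV[R]_m) (Y : 'M[R]_(m, r)) : 'cV[R]_r :=
  \col_j \prod_i (x i 0 `^ Y i j).

Definition param m dP nP (v : 'I_nP -> 'cV[R]_m) (G : 'M[R]_(m, dP))
    (xi : 'cV[R]_dP) : 'cV[R]_m :=
  (\sum_k expR (dot (v k) (G *m xi)))^-1 *:
  \sum_k expR (dot (v k) (G *m xi)) *: v k.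

Definition Fmap m dP d nP (v : 'I_nP -> 'cV[R]_m) (G : 'M[R]_(m, dP))
    (H : 'M[R]_(m, d)) (xi : 'cV[R]_dP) : 'cV[R]_d :=
  monomials (param v G xi) H.

(* The library's jacobian is stated for row vectors only. *)
Definition col_jacobian p q (f : 'cV[R]_p -> 'cV[R]_q) (x : 'cV[R]_p) :
    'M[R]_(q, p) :=
  \matrix_(i, j) ('d f x (delta_mx j 0 : 'cV[R]_p)) i 0.

(* U is meant to be open, so that f and its derivative are only
   looked at inside U. *)
Definition C1_on p q (U : set 'cV[R]_p) (f : 'cV[R]_p -> 'cV[R]_q) : Prop :=
  forall x, U x -> differentiable f x /\ {for x, continuous (col_jacobian f)}.

Definition diffeomorphism p q (U : set 'cV[R]_p) (V : set 'cV[R]_q)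
    (f : 'cV[R]_p -> 'cV[R]_q) : Prop :=
  [/\ set_bij U V f, C1_on U f &
      exists2 g : 'cV[R]_q -> 'cV[R]_p,
        (forall x, U x -> g (f x) = x) & C1_on V g].

End Defs.

Arguments positive_orthant {R} m.
Arguments simplex {R} m.

(* Main.v *)
Require Import Defs.
From HB Require Import structures.
From mathcomp Require Import all_boot all_order all_algebra.
From mathcomp Require Import all_classical all_reals all_analysis.
From mathcomp Require Import ring lra.
Import Order.TTheory GRing.Theory Num.Theory numFieldNormedType.Exports.
Local Open Scope classical_set_scope.
Local Open Scope ring_scope.

(** Write phi(xi) = H^T ln p(xi), so that F is phi followed by the exponential
    of each coordinate, a diffeomorphism from R^d onto the positive orthant.
    Everything rests on two properties of phi.

    Injectivity.  If phi(xi) = phi(xi'), then ln p(xi) - ln p(xi') lies in the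
    orthogonal complement of D, while p(xi) - p(xi') lies in T; as ln is
    increasing, these two vectors have the same sign vector, so condition (i)
    gives p(xi) = p(xi').  The parametrization p is injective because G^T p is
    the gradient of the strictly convex function ln (sum_k exp (v^k . G xi))
    of xi ([param_eq], [expo_const_eq0]).  The derivative of phi is injective
    for the same two reasons, the derivative of ln p in a direction eta being
    dp(eta) / p ([dlogmap_inj]).

    Properness.  If xi is far from 0, then p(xi) is close to the boundary of
    the polytope: p(xi) . G xi falls short of the maximum of x . G xi over the
    polytope by at most n_P, whereas a point whose coordinates are all at
    least e can be moved a distance e in the direction of G xi, which raises
    x . G xi by e |xi|, so that |xi| <= n_P / e ([param_proper]).  And when a
    point of P approaches the boundary, the vector of its log-monomials leaves
    every bounded set ([log_monomials_bounded]): if the limit has zero set I,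
    condition (ii) for the face where these coordinates vanish says that no
    vector orthogonal to D is positive on I and zero elsewhere, so by Stiemke's
    theorem of the alternative ([stiemke_alternative]) some z in D is
    nonnegative and nonzero on I; then the sum of the z_i ln x_i tends to minus
    infinity.

    Conclusion.  For surjectivity, properness provides a minimizer of
    |phi(xi) - y|, and an invertible derivative allows a first-order decrease
    of this distance unless it is 0 ([proper_regular_surjective]).  Properness
    and injectivity make the inverse continuous, and a continuous inverse of a
    C^1 map with invertible Jacobian is C^1 ([inverse_C1]).

    The vertices enter through one fact: every linear functional attains its
    maximum over the closed polytope at a vertex ([max_at_vertex]). *)

Set Implicit Arguments.
Unset Strict Implicit.
Unset Printing Implicit Defensive.

(** * Continuity of matrix-valued functions *)

Section MatrixContinuity.
Context {R : realType}.

Lemma eq_continuous_at (T U : topologicalType) (f g : T -> U) (x : T) :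
  f =1 g -> {for x, continuous g} -> {for x, continuous f}.
Proof. by move=> /funext ->. Qed.

Lemma cst_continuous_at (T U : topologicalType) (c : U) (x : T) :
  {for x, continuous (fun=> c)}.
Proof. exact: cvg_cst. Qed.

Lemma sum_continuous_at (T : topologicalType) (I : Type) (s : seq I)
    (f : I -> T -> R) (x : T) :
  (forall i, {for x, continuous (f i)}) ->
  {for x, continuous (fun y => \sum_(i <- s) f i y)}.
Proof.
move=> fc; elim: s => [|i s IHs].
  apply: (eq_continuous_at (g := fun=> 0)) => [y|]; first by rewrite big_nil.
  exact: cst_continuous_at.
apply: (eq_continuous_at (g := fun y => f i y + \sum_(j <- s) f j y)) => [y|].
  by rewrite big_cons.
exact: continuousD (fc i) IHs.
Qed.

Lemma prod_continuous_at (T : topologicalType) (I : Type) (s : seq I)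
    (f : I -> T -> R) (x : T) :
  (forall i, {for x, continuous (f i)}) ->
  {for x, continuous (fun y => \prod_(i <- s) f i y)}.
Proof.
move=> fc; elim: s => [|i s IHs].
  apply: (eq_continuous_at (g := fun=> 1 : R)) => [y|].
    by rewrite big_nil.
  exact: cst_continuous_at.
apply: (eq_continuous_at (g := fun y => f i y * \prod_(j <- s) f j y)) => [y|].
  by rewrite big_cons.
exact: continuousM (fc i) IHs.
Qed.

Lemma mx_continuous_at (T : topologicalType) m n (f : T -> 'M[R]_(m, n)) x :
  (forall i j, {for x, continuous (fun y => f y i j)}) ->
  {for x, continuous f}.
Proof.
move=> fc B [P Px PB]; rewrite /nbhs /=.
have : \forall y \near x, forall i j, P i j (f y i j).
  by apply: filter_forall => i; apply: filter_forall => j; exact: fc.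
by apply: filterS => y Py; apply: PB => i j; exact: Py.
Qed.

Lemma coord_continuous_at (T : topologicalType) m n (f : T -> 'M[R]_(m, n)) x
    i j :
  {for x, continuous f} -> {for x, continuous (fun y => f y i j)}.
Proof.
move=> fc; apply: (@continuous_comp _ _ _ f (fun M => M i j)) => //.
exact: coord_continuous.
Qed.

Lemma mulmx_continuous m n p (A : 'M[R]_(m, n)) :
  continuous (mulmx A : 'M[R]_(n, p) -> 'M[R]_(m, p)).
Proof.
move=> x; apply: mx_continuous_at => i j.
apply: (eq_continuous_at
  (g := fun y : 'M[R]_(n, p) => \sum_k A i k * y k j)) => [y|].
  by rewrite mxE.
apply: sum_continuous_at => k; apply: continuousM.
  exact: cst_continuous_at.
exact: coord_continuous.
Qed.

Lemma det_continuous n : continuous (@determinant R n).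
Proof.
move=> A; apply: sum_continuous_at => s.
apply: continuousM; first exact: cst_continuous_at.
by apply: prod_continuous_at => i; exact: coord_continuous.
Qed.

Lemma adjugate_continuous n : continuous (@adjugate R n).
Proof.
move=> A; apply: mx_continuous_at => i j.
apply: (eq_continuous_at (g := fun B : 'M[R]_n => cofactor B j i)) => [B|].
  by rewrite mxE.
rewrite /cofactor; apply: continuousM; first exact: cst_continuous_at.
apply: (@continuous_comp _ _ _ (fun B : 'M[R]_n => row' j (col' i B))
          (@determinant R n.-1)); last exact: det_continuous.
apply: mx_continuous_at => k l.
apply: (eq_continuous_at (g := fun B : 'M[R]_n => B (lift j k) (lift i l))).
  by move=> B; rewrite !mxE.
exact: coord_continuous.
Qed.

Lemma invmx_continuous_at n (A : 'M[R]_n) :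
  A \in unitmx -> {for A, continuous (@invmx R n)}.
Proof.
move=> uA; have dA : \det A != 0 by rewrite -unitfE.
suff : invmx B @[B --> A] --> (\det A)^-1 *: \adj A.
  by rewrite {1}(_ : _ *: _ = invmx A)// /invmx uA.
apply: (@cvg_trans _ ((fun B => (\det B)^-1 *: \adj B) @ nbhs A)).
  apply: (@near_eq_cvg _ _ (nbhs A)); near=> B.
  rewrite /invmx ifT// unitmxE unitfE.
  by near: B; apply: (cvgr_neq0 _ (@det_continuous n A)).
apply: cvgZ; last exact: adjugate_continuous.
by apply: cvgV => //; exact: det_continuous.
Unshelve. all: by end_near. Qed.

End MatrixContinuity.

(** * Compactness in spaces of column vectors *)

Section ColumnNorm.
Context {R : realType}.

Lemma coord_le_norm n (x : 'cV[R]_n) i : `|x i 0| <= `|x|.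
Proof.
rewrite [leRHS]/Num.norm /= mx_normrE.
exact: (le_bigmax _ (fun ij => `|x ij.1 ij.2|) (i, ord0)).
Qed.

Lemma norm_le_coord n (x : 'cV[R]_n) e :
  0 <= e -> (forall i, `|x i 0| <= e) -> `|x| <= e.
Proof.
move=> e0 xe; rewrite [leLHS]/Num.norm /= mx_normrE.
by apply: bigmax_le => // -[i j] _ /=; rewrite ord1.
Qed.

Lemma bounded_closed_compact_col n (A : set 'cV[R]_n) K :
  closed A -> (forall x, A x -> `|x| <= K) -> compact A.
Proof.
move=> Acl AK.
pose tr1 := (fun x : 'cV[R]_n => x^T) : 'cV[R]_n -> 'rV[R]_n.
pose tr2 := (fun x : 'rV[R]_n => x^T) : 'rV[R]_n -> 'cV[R]_n.
have c2 : continuous tr2.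
  move=> x; apply: mx_continuous_at => i j.
  apply: (eq_continuous_at (g := fun y : 'rV[R]_n => y j i)) => [y|].
    by rewrite !mxE.
  exact: coord_continuous.
have -> : A = tr2 @` (tr2 @^-1` A).
  apply/seteqP; split => [x Ax|_ [x Ax <-]//].
  by exists (x^T); rewrite /= /tr2 trmxK.
apply: continuous_compact; first exact: continuous_subspaceT.
apply: bounded_closed_compact; last by apply: closed_comp => // ? _; exact: c2.
exists K; split; first exact: num_real.
move=> M KM x /= /AK xK; apply: le_trans (ltW KM).
rewrite [leLHS]/Num.norm /= mx_normrE; apply: bigmax_le => [|[i j] _ /=].
  exact: le_trans xK.
by rewrite ord1 (le_trans _ xK)// (le_trans _ (coord_le_norm _ j))// !mxE.
Qed.

Lemma closed_norm_ball n K : closed [set x : 'cV[R]_n | `|x| <= K].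
Proof.
apply: (@closed_comp _ _ (fun x : 'cV[R]_n => `|x|) [set r : R | r <= K]).
  by move=> x _; exact: norm_continuous.
exact: closed_le.
Qed.

Lemma compact_norm_ball n K : compact [set x : 'cV[R]_n | `|x| <= K].
Proof.
by apply: (bounded_closed_compact_col (@closed_norm_ball n K)) => x; exact.
Qed.

End ColumnNorm.

(** * Differentials of maps between column spaces *)

Section ColumnDifferential.
Context {R : realType}.

Lemma eq_is_diff (V W : normedModType R) (f g df dg : V -> W) (x : V) :
  f =1 g -> df =1 dg -> is_diff x g dg -> is_diff x f df.
Proof. by move=> /funext -> /funext ->. Qed.

Lemma is_diff_sum (V W : normedModType R) (I : Type) (s : seq I)
    (f df : I -> V -> W) (x : V) :
  (forall i, is_diff x (f i) (df i)) ->
  is_diff x (fun y => \sum_(i <- s) f i y) (fun h => \sum_(i <- s) df i h).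
Proof.
move=> fd; elim: s => [|i s IHs].
  by apply: eq_is_diff (is_diff_cst (0 : W) x) => y; rewrite big_nil.
by apply: eq_is_diff (is_diffD (fd i) IHs) => y; rewrite big_cons.
Qed.

Lemma is_diff_col (V : normedModType R) n (f df : V -> 'cV[R]_n) (x : V) :
  (forall i, is_diff x (fun y => f y i 0) (fun h => df h i 0)) ->
  is_diff x f df.
Proof.
move=> fd.
have colE (g : V -> 'cV[R]_n) : g = fun y => \sum_i g y i 0 *: delta_mx i 0.
  apply/funext => y; rewrite {1}[g y]matrix_sum_delta.
  by apply: eq_bigr => i _; rewrite big_ord1.
rewrite (colE f) (colE df); apply: is_diff_sum => i.
exact: (is_diff_comp (fd i) (is_diff_scalel (f x i 0) (delta_mx i 0))).
Qed.

Lemma is_diff_mulmx m n (A : 'M[R]_(m, n)) (x : 'cV[R]_n) :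
  is_diff x (mulmx A) (mulmx A).
Proof.
have Ac := @mulmx_continuous _ _ _ 1 A.
by apply: DiffDef; [exact: (linear_differentiable x Ac)|exact: (diff_lin x Ac)].
Qed.

Lemma col_jacobianE p q (f : 'cV[R]_p -> 'cV[R]_q) x h :
  'd f x h = col_jacobian f x *m h.
Proof.
rewrite {1}[h]matrix_sum_delta linear_sum; apply/colP => i.
rewrite summxE mxE; apply: eq_bigr => j _.
by rewrite big_ord1 linearZ /= !mxE mulrC.
Qed.

(** The Jacobian is given by the partial derivatives [df] only inside U; as U is
    open, they agree near each of its points, so that continuity transfers. *)
Lemma C1_on_is_diff p q (U : set 'cV[R]_p) (f : 'cV[R]_p -> 'cV[R]_q)
    (df : 'cV[R]_p -> 'cV[R]_p -> 'cV[R]_q) :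
  open U -> (forall x, U x -> is_diff x f (df x)) ->
  (forall x h i, U x -> {for x, continuous (fun y => df y h i 0)}) ->
  C1_on U f.
Proof.
move=> Uo fd dfc x Ux; split; first by have := fd _ Ux.
apply: mx_continuous_at => i j.
apply: (@cvg_trans _ ((fun y => df y (delta_mx j 0) i 0) @ nbhs x)).
  apply: (@near_eq_cvg _ _ (nbhs x)); near=> y; rewrite /= mxE.
  have Uy : U y by near: y; exact: open_nbhs_nbhs.
  by rewrite (@diff_val _ _ _ _ _ _ _ (fd _ Uy)).
rewrite mxE (@diff_val _ _ _ _ _ _ _ (fd _ Ux)); exact: dfc.
Unshelve. all: by end_near. Qed.

End ColumnDifferential.

(** * Proper maps with invertible Jacobian *)

Section GlobalInverse.
Context {R : realType} {n : nat}.
Implicit Types f g : 'cV[R]_n -> 'cV[R]_n.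

(** Closed balls being compact, this is properness for continuous maps. *)
Definition proper_map f :=
  forall M, exists K, forall x, `|f x| <= M -> `|x| <= K.

Lemma diff_remainder f x e : 0 < e -> differentiable f x ->
  \forall k \near (0 : 'cV[R]_n),
    `|f (k + x) - (f x + col_jacobian f x *m k)| <= e * `|k|.
Proof.
move=> e0 /diff_locally/eqaddoP/(_ _ e0); apply: filterS => k /=.
by rewrite -col_jacobianE.
Qed.

(** Properness yields a minimizer c of |f x - y|.  If f c - y = r <> 0, moving
    from c along the solution k of J k = - r changes f c - y to (1 - t) r up to
    o(t), which is shorter for small t.  The argument works for any norm. *)
Lemma proper_regular_surjective f :
  (forall x, differentiable f x) ->
  (forall x, col_jacobian f x \in unitmx) ->
  proper_map f -> forall y, exists x, f x = y.
Proof.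
move=> fd fu fp y.
have fc : continuous (fun x => `|f x - y|).
  move=> x; apply: continuous_comp; last exact: norm_continuous.
  apply: continuousB; last exact: cst_continuous_at.
  exact: differentiable_continuous.
have [K fK] := fp (`|f 0 - y| + `|y|).
have bnd x : `|f x - y| <= `|f 0 - y| -> `|x| <= K.
  move=> xy; apply: fK; rewrite -(subrK y (f x)).
  by rewrite (le_trans (ler_normD _ _))// lerD2r.
have [||| c _ cmin] := @compact_EVT_min _ _ (fun x => `|f x - y|)
    [set x : 'cV[R]_n | `|x| <= K].
- by exists 0; exact: bnd.
- exact: compact_norm_ball.
- exact: continuous_subspaceT.
have {}cmin x : `|f c - y| <= `|f x - y|.
  have [xK|Kx] := leP `|x| K; first by apply: cmin; rewrite inE.
  have [x0|x0] := leP `|f x - y| `|f 0 - y|.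
    by move: Kx; rewrite ltNge bnd.
  by apply: le_trans (ltW x0); apply: cmin; rewrite inE; exact: bnd.
exists c; apply: contrapT => /eqP; rewrite -subr_eq0 => r0.
set r := f c - y in r0.
pose k := - (invmx (col_jacobian f c) *m r).
have Jk : col_jacobian f c *m k = - r by rewrite mulmxN mulKVmx.
(* The remainder must stay below t |r|; this e makes e |k| < |r|. *)
pose e := `|r| / (2 * (`|k| + 1)).
have k1 : 0 < `|k| + 1 by rewrite ltr_wpDl.
have e0 : 0 < e by rewrite divr_gt0 ?normr_gt0 ?mulr_gt0.
have ek : e * `|k| < `|r|.
  rewrite /e mulrAC ltr_pdivrMr ?mulr_gt0// ltr_pM2l ?normr_gt0//.
  by have := normr_ge0 k; lra.
have small : \forall t \near (0 : R)^'+,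
    `|f (t *: k + c) - (f c + col_jacobian f c *m (t *: k))| <= e * `|t *: k|.
  have : (t *: k) @[t --> (0 : R)^'+] --> (0 : 'cV[R]_n).
    rewrite -[X in _ --> X](scale0r k); apply: cvgZr_tmp.
    exact: cvg_at_right_filter.
  by move=> /(_ _ (diff_remainder e0 (fd c))).
near (0 : R)^'+ => t.
have t0 : 0 < t by [].
have t1 : t < 1 by near: t; exact: nbhs_right_lt.
have : `|f (t *: k + c) - (f c + col_jacobian f c *m (t *: k))|
    <= e * `|t *: k| by near: t.
rewrite -scalemxAr Jk normrZ gtr0_norm// => rem.
have := cmin (t *: k + c); apply/negP; rewrite -ltNge.
have -> : f (t *: k + c) - y =
    (f (t *: k + c) - (f c + t *: - r)) + (1 - t) *: r.
  rewrite scalerBl scale1r scalerN /r.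
  by apply/colP => i; rewrite !mxE; ring.
rewrite (le_lt_trans (ler_normD _ _))// normrZ gtr0_norm ?subr_gt0//.
rewrite (@le_lt_trans _ _ (e * (t * `|k|) + (1 - t) * `|r|)) ?lerD2r//.
rewrite mulrCA.
have : t * (e * `|k|) < t * `|r| by rewrite ltr_pM2l.
rewrite -/r; lra.
Unshelve. all: by end_near. Qed.

(** By properness, all preimages of points near y lie in one compact ball B.
    For a neighbourhood U of g y, the image of B minus U is compact, hence
    closed, and misses y by injectivity; so g maps points near y into U. *)
Lemma proper_injective_inverse_continuous f g :
  continuous f -> injective f -> proper_map f -> cancel g f -> continuous g.
Proof.
move=> fc fi fp gK y U Uy.
have [K fK] := fp (`|y| + 1).
have cB : compact ([set x : 'cV[R]_n | `|x| <= K] `\` U^°).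
  apply: (@subclosed_compact _ _ [set x : 'cV[R]_n | `|x| <= K]).
  - apply: closedI; first exact: closed_norm_ball.
    by apply: open_closedC; exact: open_interior.
  - exact: compact_norm_ball.
  - by move=> x [].
have /compact_closed : compact (f @` ([set x : 'cV[R]_n | `|x| <= K] `\` U^°)).
  by apply: continuous_compact => //; exact: continuous_subspaceT.
move=> /(_ (@norm_hausdorff _ _)) cfB.
have : \forall y' \near y, ~ (f @` ([set x : 'cV[R]_n | `|x| <= K] `\` U^°)) y'.
  apply: open_nbhs_nbhs; split; first exact: closed_openC.
  move=> [x [_ xU] fxy]; apply: xU; rewrite (_ : x = g y)//.
  by apply: fi; rewrite gK.
have : \forall y' \near y, `|y'| < `|y| + 1.
  apply: (cvgr_lt _ (@norm_continuous _ _ y)); lra.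
apply: filterS2 => y' y'M y'f; rewrite /=.
apply: contrapT => gU; apply: y'f; exists (g y'); last exact: gK.
split; first by apply: fK; rewrite gK ltW.
by move=> /interior_subset.
Qed.

(** With x = g y, k = g (y + h) - x and L the inverse of the Jacobian of f at x,
    applying L to h = J k + o(k) gives k = L h + o(k).  Continuity of g makes
    k small, so this relation first bounds |k| by a multiple of |h| and then
    turns o(k) into o(h). *)
Lemma inverse_C1 f g (V : set 'cV[R]_n) :
  open V -> C1_on setT f -> (forall x, col_jacobian f x \in unitmx) ->
  (forall y, V y -> f (g y) = y) -> (forall y, V y -> {for y, continuous g}) ->
  C1_on V g.
Proof.
move=> Vo fC1 fu gK gc.
have gd y : V y -> is_diff y g (mulmx (invmx (col_jacobian f (g y)))).
  move=> Vy; set L := invmx _.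
  have Lc := @mulmx_continuous R n n 1 L.
  have gE : g \o shift y = cst (g y) + (mulmx L) +o_ (0 : 'cV[R]_n) id.
    have [c c0 Lip] := linear_lipschitz Lc.
    apply/eqaddoP => e e0.
    (* The first bound yields |k| <= 2 c |h|; the second one converts the error
       c e' |k| into e |h|. *)
    pose e' := Num.min (2 * c)^-1 (e / (2 * c ^+ 2)).
    have e'0 : 0 < e' by rewrite lt_min invr_gt0 divr_gt0 ?mulr_gt0 ?exprn_gt0.
    have cs : (h + y) @[h --> (0 : 'cV[R]_n)] --> y.
      rewrite -[X in _ --> X]add0r.
      exact: (cvgD (@cvg_id _ (nbhs (0 : 'cV[R]_n))) (cvg_cst y)).
    have cont : (g (h + y) - g y) @[h --> (0 : 'cV[R]_n)] --> (0 : 'cV[R]_n).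
      rewrite -[X in _ --> X](subrr (g y)).
      exact: (cvgB (cvg_comp _ _ cs (gc _ Vy)) (cvg_cst (g y))).
    have H1 : \forall h \near (0 : 'cV[R]_n),
        `|f (g (h + y) - g y + g y) -
           (f (g y) + col_jacobian f (g y) *m (g (h + y) - g y))|
        <= e' * `|g (h + y) - g y|.
      exact: (cont _ (diff_remainder e'0 (fC1 (g y) I).1)).
    have H2 : \forall h \near (0 : 'cV[R]_n), V (h + y).
      by apply: cs; exact: open_nbhs_nbhs.
    near=> h.
    have Vh : V (h + y) by near: h.
    have : `|f (g (h + y) - g y + g y) -
              (f (g y) + col_jacobian f (g y) *m (g (h + y) - g y))|
           <= e' * `|g (h + y) - g y| by near: h.
    set k := g (h + y) - g y.
    rewrite subrK gK// gK// opprD addrA addrK => H.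
    have kL : `|k - L *m h| <= c * (e' * `|k|).
      apply: le_trans (ler_wpM2l (ltW c0) H); apply: le_trans (Lip _).
      by rewrite /= mulmxBr mulKmx// -normrN opprB.
    have e'1 : e' <= (2 * c)^-1 by rewrite ge_min lexx.
    have e'2 : e' <= e / (2 * c ^+ 2) by rewrite ge_min lexx orbT.
    have ce : c * e' <= 2^-1.
      by rewrite mulrC -ler_pdivlMr// -invfM.
    have kh : `|k| <= 2 * c * `|h|.
      have k0 := normr_ge0 k.
      have : `|k| <= `|k - L *m h| + `|L *m h|.
        by rewrite -{1}(subrK (L *m h) k) ler_normD.
      have := Lip h; rewrite /= => Lh.
      have : c * (e' * `|k|) <= 2^-1 * `|k| by rewrite mulrA ler_wpM2r.
      lra.
    rewrite -[X in `|X|]/(g (h + y) - (g y + L *m h)) opprD addrA.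
    apply: le_trans kL _.
    apply: (@le_trans _ _ (c * (e' * (2 * c * `|h|)))).
      by rewrite ler_pM2l// ler_pM2l.
    have -> : c * (e' * (2 * c * `|h|)) = e' * (2 * c ^+ 2) * `|h| by ring.
    by rewrite ler_wpM2r// -ler_pdivlMr// mulr_gt0// exprn_gt0.
  have dg : 'd g y = mulmx L :> (_ -> _) by exact: (diff_unique Lc gE).
  apply: DiffDef => //; apply/diff_locallyP; rewrite dg; split => //.
apply: (C1_on_is_diff Vo gd) => y h i Vy; apply: coord_continuous_at.
have Jc : {for y, continuous (fun z => invmx (col_jacobian f (g z)))}.
  apply: (@continuous_comp _ _ _ g (fun z => invmx (col_jacobian f z))).
    exact: gc.
  apply: (@continuous_comp _ _ _ (col_jacobian f) (@invmx R n)).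
    exact: (fC1 (g y) I).2.
  exact: invmx_continuous_at.
apply: mx_continuous_at => k j.
apply: (eq_continuous_at
  (g := fun z => \sum_l invmx (col_jacobian f (g z)) k l * h l j)) => [z|].
  by rewrite mxE.
apply: sum_continuous_at => l; apply: continuousM.
  exact: coord_continuous_at.
exact: cst_continuous_at.
Unshelve. all: by end_near. Qed.

End GlobalInverse.

(** * The dot product *)

Section Dot.
Context {R : realType} {m : nat}.
Implicit Types x y z : 'cV[R]_m.

Lemma dotE x y : dot x y = (x^T *m y) 0 0.
Proof. by rewrite mxE; apply: eq_bigr => i _; rewrite mxE. Qed.

Lemma dotC x y : dot x y = dot y x.
Proof. by apply: eq_bigr => i _; rewrite mulrC. Qed.

Lemma dotDr x y z : dot x (y + z) = dot x y + dot x z.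
Proof. by rewrite !dotE mulmxDr mxE. Qed.

Lemma dotZr k x y : dot x (k *: y) = k * dot x y.
Proof. by rewrite !dotE -scalemxAr mxE. Qed.

Lemma dotNr x y : dot x (- y) = - dot x y.
Proof. by rewrite !dotE mulmxN mxE. Qed.

Lemma dotBr x y z : dot x (y - z) = dot x y - dot x z.
Proof. by rewrite dotDr dotNr. Qed.

Lemma dot0r x : dot x 0 = 0.
Proof. by rewrite dotE mulmx0 mxE. Qed.

Lemma dot_sumr x (I : finType) (f : I -> 'cV[R]_m) :
  dot x (\sum_i f i) = \sum_i dot x (f i).
Proof.
rewrite dotE mulmx_sumr summxE; apply: eq_bigr => i _; exact: esym (dotE _ _).
Qed.

Lemma dot_ge0 x : 0 <= dot x x.
Proof. by apply: sumr_ge0 => i _; rewrite -expr2 sqr_ge0. Qed.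

Lemma dot_eq0 x : dot x x = 0 -> x = 0.
Proof.
move=> /psumr_eq0P x0; apply/colP => i; rewrite mxE.
have /eqP : x i 0 * x i 0 = 0 by apply: x0 => // j _; rewrite -expr2 sqr_ge0.
by rewrite mulf_eq0 orbb => /eqP.
Qed.

Lemma dot_gt0 x : x != 0 -> 0 < dot x x.
Proof.
move=> x0; rewrite lt_neqAle dot_ge0 andbT eq_sym.
by apply: contra x0 => /eqP/dot_eq0 ->.
Qed.

Lemma dot_continuous x : continuous (dot x).
Proof.
move=> y; apply: sum_continuous_at => i; apply: continuousM.
  exact: cst_continuous_at.
exact: coord_continuous.
Qed.

Lemma dot_delta x i : dot (delta_mx i 0) x = x i 0.
Proof.
rewrite /dot (bigD1 i)//= mxE !eqxx mul1r big1 ?addr0// => j ji.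
by rewrite mxE (negPf ji) mul0r.
Qed.

Lemma coord_le_sqrt_dot x i : `|x i 0| <= Num.sqrt (dot x x).
Proof.
rewrite -sqrtr_sqr ler_wsqrtr// /dot (bigD1 i)//= -expr2 lerDl.
by apply: sumr_ge0 => j _; rewrite -expr2 sqr_ge0.
Qed.

Lemma dot_le_norm c x :
  dot c x <= (\sum_i `|c i 0|) * `|x|.
Proof.
rewrite mulr_suml; apply: ler_sum => i _.
by rewrite (le_trans (ler_norm _))// normrM ler_wpM2l// coord_le_norm.
Qed.

End Dot.

Lemma dot_mulmx (R : realType) m n (M : 'M[R]_(m, n)) x y :
  dot (M *m x) y = dot x (M^T *m y).
Proof. by rewrite !dotE trmx_mul mulmxA. Qed.

(** * Stiemke's theorem of the alternative *)

(** The nonnegative quantity 2 t b + t^2 a is dominated by its linear term as t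
    tends to 0. *)
Lemma slope_ge0 (R : realType) (a b : R) : 0 <= a ->
  (forall t, 0 < t -> t <= 1 -> 0 <= 2 * t * b + t ^+ 2 * a) -> 0 <= b.
Proof.
move=> a0 H; rewrite leNgt; apply/negP => b0.
pose t := Num.min 1 (- b / (a + 1)).
have a1 : 0 < a + 1 by lra.
have t0 : 0 < t by rewrite lt_min ltr01 divr_gt0// oppr_gt0.
have t1 : t <= 1 by rewrite ge_min lexx.
have tb : t * (a + 1) <= - b by rewrite -ler_pdivlMr// ge_min lexx orbT.
have := H _ t0 t1; rewrite (_ : _ + _ = t * (2 * b + t * a)); last by ring.
by rewrite pmulr_rge0//; lra.
Qed.

Section Alternative.
Context {R : realType} {m d : nat}.

(** Nonnegative coordinates with sum 1 are at most 1. *)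
Lemma simplex_compact (S : set 'cV[R]_m) :
  closed S -> (forall y, S y -> forall i, 0 <= y i 0) ->
  (forall y, S y -> \sum_i y i 0 = 1) -> compact S.
Proof.
move=> Scl S0 S1; apply: (bounded_closed_compact_col (K := 1) Scl) => y Sy.
apply: norm_le_coord => // i; rewrite ger0_norm ?S0// -(S1 _ Sy).
by rewrite (bigD1 i)//= lerDl; apply: sumr_ge0 => j _; exact: S0.
Qed.

Lemma closed_coord_ge0 i : closed [set y : 'cV[R]_m | 0 <= y i 0].
Proof.
apply: (@closed_comp _ _ (fun y : 'cV[R]_m => y i 0) [set r : R | 0 <= r]).
  by move=> y _; exact: coord_continuous.
exact: closed_ge.
Qed.

Lemma closed_continuous_eq (h : 'cV[R]_m -> R) c :
  continuous h -> closed [set y | h y = c].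
Proof.
move=> hc; apply: (@closed_comp _ _ h [set r : R | r = c]).
  by move=> y _; exact: hc.
exact: closed_eq.
Qed.

(** Let Q be a matrix whose kernel is the column space of H with the rows
    outside I set to 0.  Minimize |Q y|^2 over the probability vectors y
    supported in I.  If the minimum is 0, then y is in the kernel of Q, which
    is the first alternative.  Otherwise half the gradient, q = Q^T Q y,
    restricted to I, gives the second one: q is orthogonal to the kernel of Q,
    and minimality towards the vertex e_i of the simplex gives
    q_i >= |Q y|^2 > 0 for each i in I. *)
Lemma stiemke_alternative (H : 'M[R]_(m, d)) (I : {pred 'I_m}) :
  (exists c : 'cV[R]_d, (forall i, i \in I -> 0 <= (H *m c) i 0) /\
             (exists2 i, i \in I & 0 < (H *m c) i 0)) \/
  (exists y : 'cV[R]_m, [/\ H^T *m y = 0, forall i, i \in I -> 0 < y i 0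
               & forall i, i \notin I -> y i 0 = 0]).
Proof.
(* For empty I the simplex is empty, and y = 0 works. *)
have [i0 i0I|I0] := pickP (mem I); last first.
  right; exists 0; split => [|i iI|i _]; rewrite ?mulmx0 ?mxE//.
  by have := I0 i; rewrite /= iI.
pose E : 'M[R]_m := \matrix_(i, j) ((i == j) && (i \in I))%:R.
have Emul p (M : 'M[R]_(m, p)) i j : (E *m M) i j = (i \in I)%:R * M i j.
  rewrite mxE (bigD1 i)//= mxE eqxx big1 ?addr0// => k ki.
  by rewrite mxE eq_sym (negPf ki) mul0r.
pose K := E *m H; pose Q := (cokermx K^T)^T.
have QK : Q *m K = 0.
  by apply: trmx_inj; rewrite trmx_mul trmxK mulmx_coker trmx0.
pose S := [set y : 'cV[R]_m | [/\ forall i, 0 <= y i 0,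
   forall i, i \notin I -> y i 0 = 0 & \sum_i y i 0 = 1]].
have sumc : continuous (fun y : 'cV[R]_m => \sum_i y i 0).
  by move=> y; apply: sum_continuous_at => i; exact: coord_continuous.
have Scl : closed S.
  rewrite (_ : S = (\bigcap_i [set y | 0 <= y i 0]) `&`
     (\bigcap_(i in [set i | i \notin I]) [set y | y i 0 = 0]) `&`
     [set y | \sum_i y i 0 = 1]).
    apply: closedI; last exact: closed_continuous_eq.
    apply: closedI; apply: closed_bigI => i _; first exact: closed_coord_ge0.
    by apply: closed_continuous_eq; exact: coord_continuous.
  apply/seteqP; split => [y [y0 yI y1]|y [[y0 yI] y1]].
    by split => //; split => i iI; [exact: y0|exact: yI].
  by split=> [i|i iI|]; [exact: y0|exact: yI|].
have Sdelta i : i \in I -> S (delta_mx i 0).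
  move=> iI; split=> [j|j jI|]; rewrite ?mxE ?ler0n//.
    by case: eqP jI iI => // -> /negPf ->.
  rewrite (bigD1 i)//= mxE !eqxx big1 ?addr0// => j ji.
  by rewrite mxE (negPf ji).
pose f y := dot (Q *m y) (Q *m y).
have fc : continuous f.
  move=> y; apply: sum_continuous_at => i; apply: continuousM;
  by apply: coord_continuous_at; exact: mulmx_continuous.
have [||| y Sy ymin] := @compact_EVT_min _ _ f S.
- by exists (delta_mx i0 0); exact: Sdelta.
- by apply: simplex_compact => // y [].
- exact: continuous_subspaceT.
rewrite inE in Sy; have [y0 yI y1] := Sy.
have [Qy0|Qy0] := eqVneq (Q *m y) 0.
  left; have : (y^T <= K^T)%MS.
    by rewrite submxE -[cokermx _]trmxK -trmx_mul -/Q Qy0 trmx0.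
  move=> /submxP[c yc]; exists c^T.
  have Hy i : i \in I -> (H *m c^T) i 0 = y i 0.
    move=> iI; rewrite -[y]trmxK yc trmx_mul trmxK -mulmxA.
    by rewrite Emul iI mul1r.
  split=> [i iI|]; first by rewrite Hy.
  apply: contrapT => nex; suff : \sum_i y i 0 <= 0 by rewrite y1 ler10.
  apply: sumr_le0 => i _; have [iI|/yI->//] := boolP (i \in I).
  by rewrite leNgt; apply/negP => yi; apply: nex; exists i; rewrite ?Hy.
right; pose q := Q^T *m (Q *m y).
have q0 i : i \in I -> 0 < q i 0.
  move=> iI; pose z : 'cV[R]_m := delta_mx i 0 - y.
  have b0 : 0 <= dot (Q *m y) (Q *m z).
    apply: (@slope_ge0 _ (dot (Q *m z) (Q *m z))); first exact: dot_ge0.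
    move=> t t0 t1; have [e0 eI e1] := Sdelta _ iI.
    have : f y <= f (y + t *: z).
      apply: ymin; rewrite inE; split=> [j|j jI|].
      - rewrite !mxE (_ : _ + _ =
            (1 - t) * y j 0 + t * (delta_mx i 0 : 'cV[R]_m) j 0).
          by rewrite addr_ge0// mulr_ge0 ?subr_ge0// ltW.
        by rewrite !mxE; ring.
      - by rewrite !mxE yI//; have := eI _ jI; rewrite !mxE => ->; ring.
      - transitivity
          (\sum_j ((1 - t) * y j 0 + t * (delta_mx i 0 : 'cV[R]_m) j 0)).
          by apply: eq_bigr => j _; rewrite !mxE; ring.
        by rewrite big_split/= -!mulr_sumr y1 e1; ring.
    rewrite /f mulmxDr -scalemxAr.
    move: (Q *m y) (Q *m z) => u w.
    rewrite dotDr dotZr ![dot (u + _) _]dotC !dotDr !dotZr [dot w u]dotC.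
    by move=> H1; nra.
  rewrite -dot_delta /q dotC dot_mulmx trmxK.
  rewrite -[delta_mx i 0](subrK y) -/z mulmxDr dotDr.
  by rewrite ltr_wpDl// dot_gt0.
exists (E *m q); split => [|i iI|i iI].
- have -> : H^T *m (E *m q) = K^T *m q.
    rewrite trmx_mul mulmxA; congr (_ *m _ *m _); apply/matrixP => i j.
    by rewrite !mxE eq_sym; case: eqP => // ->.
  by rewrite mulmxA -trmx_mul QK trmx0 mul0mx.
- by rewrite Emul iI mul1r q0.
- by rewrite Emul (negPf iI) mul0r.
Qed.

End Alternative.

(** * Membership in kernels and images *)

Section Kernel.
Context {R : realType} {m : nat}.

Lemma mem_mxKer k (A : 'M[R]_(k, m)) x : (x \in mxKer A) = (A *m x == 0).
Proof.
rewrite memv_ker -[linfun _]/(linfun (mulmx A : 'cV[R]_m -> 'cV[R]_k)).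
by rewrite lfunE.
Qed.

Lemma mem_mxIm k (G : 'M[R]_(m, k)) x : x \in mxIm G <-> exists c, x = G *m c.
Proof.
rewrite /mxIm -[linfun _]/(linfun (mulmx G : 'cV[R]_k -> 'cV[R]_m)).
split=> [/memv_imgP[c _ ->]|[c ->]]; first by exists c; rewrite lfunE.
by apply/memv_imgP; exists c; rewrite ?memvf// lfunE.
Qed.

Lemma mem_ker_ones l (A : 'M[R]_(l, m)) x :
  x \in mxKer (add_ones_row A) <-> A *m x = 0 /\ \sum_i x i 0 = 0.
Proof.
rewrite mem_mxKer mul_col_mx col_mx_eq0.
have -> : (const_mx 1 *m x == 0 :> 'cV[R]_1) = (\sum_i x i 0 == 0).
  apply/eqP/eqP => [/colP/(_ 0)|H].
    rewrite !mxE => H; rewrite -[RHS]H.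
    by apply: eq_bigr => i _; rewrite mxE mul1r.
  apply/colP => i; rewrite !mxE -[RHS]H.
  by apply: eq_bigr => j _; rewrite mxE mul1r.
by split=> [/andP[/eqP -> /eqP ->]//|[-> ->]]; rewrite !eqxx.
Qed.

End Kernel.

(** * The closed coefficient polytope and its vertices *)

Section Polytope.
Context {R : realType} {l m : nat} (A : 'M[R]_(l, m)).

Definition affine_slice : set 'cV[R]_m :=
  [set x | A *m x = 0 /\ \sum_i x i 0 = 1].

Lemma coef_polytopeE :
  coef_polytope A = [set x | affine_slice x /\ forall i, 0 < x i 0].
Proof.
have s1 x : dot (const_mx 1) x = \sum_i x i 0 :> R.
  by apply: eq_bigr => i _; rewrite mxE mul1r.
apply/seteqP; split=> x /=.
  move=> [[]] /=; rewrite mem_mxKer => /eqP Ax x0 [_] /=; rewrite s1 => x1.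
  by do !split.
move=> [[Ax x1] x0]; split; split => //=; first by rewrite mem_mxKer Ax.
  by move=> i; rewrite ltW.
by rewrite s1.
Qed.

Lemma affine_slice_line x y t :
  affine_slice x -> A *m y = 0 -> \sum_i y i 0 = 0 -> affine_slice (x + t *: y).
Proof.
move=> [Ax x1] Ay y0; split.
  by rewrite mulmxDr -scalemxAr Ax Ay scaler0 addr0.
under eq_bigr do rewrite 2!mxE.
by rewrite big_split/= -mulr_sumr y0 mulr0 addr0.
Qed.

Lemma affine_slice_sub x y : affine_slice x -> affine_slice y ->
  A *m (y - x) = 0 /\ \sum_i (y - x) i 0 = 0.
Proof.
move=> [Ax x1] [Ay y1]; split; first by rewrite mulmxBr Ax Ay subrr.
under eq_bigr do rewrite 2!mxE.
by rewrite sumrB x1 y1 subrr.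
Qed.

Lemma closed_polytope_ineq :
  closed [set x | affine_slice x /\ forall i, 0 <= x i 0].
Proof.
rewrite (_ : mkset _ = (\bigcap_i [set x | (A *m x) i 0 = 0]) `&`
   [set x | \sum_i x i 0 = 1] `&` (\bigcap_i [set x : 'cV[R]_m | 0 <= x i 0])).
  apply: closedI; first apply: closedI.
  - apply: closed_bigI => i _; apply: closed_continuous_eq => x.
    by apply: coord_continuous_at; exact: mulmx_continuous.
  - apply: closed_continuous_eq => x; apply: sum_continuous_at => i.
    exact: coord_continuous.
  - by apply: closed_bigI => i _; exact: closed_coord_ge0.
apply/seteqP; split => [x [[Ax x1] x0]|x [[Ax x1] x0]].
  by split => [|i _]; [split => // i _ /=; rewrite Ax mxE|exact: x0].
split=> [|i]; [split => //|exact: x0].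
by apply/colP => i; rewrite [RHS]mxE; exact: Ax.
Qed.

Lemma compact_polytope_ineq :
  compact [set x | affine_slice x /\ forall i, 0 <= x i 0].
Proof.
by apply: simplex_compact closed_polytope_ineq _ _ => [y [_ y0]|y [[_ y1] _]].
Qed.

(** The segment from a solution x of the weak inequalities to a point p of P
    lies in P except possibly for x, so x is in the closure of P. *)
Lemma closed_coef_polytopeE : coef_polytope A !=set0 ->
  closed_coef_polytope A = [set x | affine_slice x /\ forall i, 0 <= x i 0].
Proof.
rewrite /closed_coef_polytope coef_polytopeE => -[p [pA p0]].
apply/seteqP; split.
  move=> x /(closure_subset
    (B := [set x | affine_slice x /\ forall i, 0 <= x i 0])).
  rewrite -(closure_id _).1; last exact: closed_polytope_ineq.
  by apply=> y [yA y0]; split=> // i; rewrite ltW.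
move=> x [xA x0] B Bx.
have cx : (x + t *: (p - x)) @[t --> (0 : R)^'+] --> x.
  rewrite -[X in _ --> X]addr0 -(scale0r (p - x)).
  apply: cvgD; first exact: cvg_cst.
  by apply: cvgZr_tmp; exact: cvg_at_right_filter.
near (0 : R)^'+ => t.
have t0 : 0 < t by [].
have t1 : t < 1 by near: t; exact: nbhs_right_lt.
exists (x + t *: (p - x)); split; last by near: t; exact: (cx _ Bx).
split=> [|i].
  by have [? ?] := affine_slice_sub xA pA; exact: affine_slice_line.
have -> : (x + t *: (p - x)) i 0 = (1 - t) * x i 0 + t * p i 0.
  by rewrite !mxE; ring.
by rewrite ltr_wpDl// ?mulr_ge0 ?mulr_gt0 ?subr_ge0 ?(ltW t1)//; exact: p0.
Unshelve. all: by end_near. Qed.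

Definition supp (x : 'cV[R]_m) : {set 'I_m} := [set i | x i 0 != 0]%SET.

(** As e has sum 0 and is nonzero, it has a negative coordinate; follow the ray
    until the first coordinate vanishes. *)
Lemma ray_shrinks_support x e :
  affine_slice x -> (forall i, 0 <= x i 0) ->
  A *m e = 0 -> \sum_i e i 0 = 0 -> e != 0 ->
  (forall i, x i 0 = 0 -> e i 0 = 0) ->
  exists t, [/\ 0 < t, forall i, 0 <= (x + t *: e) i 0
    & supp (x + t *: e) \proper supp x].
Proof.
move=> xA x0 Ae e1 e0 xe.
have [i0 ei0] : exists i, e i 0 < 0.
  apply: contrapT => /forallNP ne; case/negP: e0; apply/eqP/colP => i.
  have ep j : true -> 0 <= e j 0 by move=> _; rewrite leNgt; apply/negP/ne.
  by rewrite mxE; exact: (psumr_eq0P ep e1).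
case: (@arg_minP _ _ _ i0 (fun i => e i 0 < 0) (fun i => x i 0 / - e i 0) ei0)
  => i ei imin.
have xpos j : e j 0 < 0 -> 0 < x j 0.
  move=> ej; rewrite lt_neqAle x0 andbT eq_sym; apply/eqP => /xe ej0.
  by rewrite ej0 ltxx in ej.
set t := x i 0 / - e i 0 in imin.
have t0 : 0 < t by rewrite divr_gt0 ?oppr_gt0// xpos.
have ti : (x + t *: e) i 0 = 0.
  by rewrite !mxE /t; field; rewrite lt_eqF.
exists t; split => // [j|].
  rewrite !mxE; have [ej|ej] := leP 0 (e j 0).
    by rewrite addr_ge0// mulr_ge0// ltW.
  have := imin _ ej; rewrite ler_pdivlMr ?oppr_gt0//; lra.
apply/properP; split.
  apply/fintype.subsetP => j; rewrite !inE; apply: contra => /eqP xj.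
  by rewrite !mxE xj (xe _ xj) mulr0 addr0.
by exists i; rewrite !inE ?ti ?eqxx// gt_eqF// xpos.
Qed.

Hypothesis P_neq0 : coef_polytope A !=set0.
Let Q := closed_coef_polytope A.

(** Among the maximizers of c take one, x, with the smallest support.  It is the
    only point of the face where the coordinates vanishing at x vanish: for a
    second point y, the rays from x in the directions y - x and x - y both
    remain in the polytope, so c is constant along them, and the former ends in
    a maximizer with smaller support. *)
Lemma max_at_vertex (c : 'cV[R]_m) :
  exists v, is_vertex Q v /\ forall x, Q x -> dot c x <= dot c v.
Proof.
have QE : Q = [set x | affine_slice x /\ forall i, 0 <= x i 0].
  exact: closed_coef_polytopeE.
have [||| x1 Qx1 x1max] := @compact_EVT_max _ _ (dot c) Q.
- have [p] := P_neq0; rewrite coef_polytopeE => -[pA p0].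
  by exists p; rewrite QE; split => // i; exact: ltW.
- by rewrite QE; exact: compact_polytope_ineq.
- by apply: continuous_subspaceT; exact: dot_continuous.
rewrite inE in Qx1.
have {}x1max x : Q x -> dot c x <= dot c x1.
  by move=> Qx; apply: x1max; rewrite inE.
pose good k := `[< exists2 x, Q x /\ dot c x = dot c x1
                  & #|supp x| = k >].
have exg : exists k, good k by eexists; apply/asboolP; exists x1.
case: (ex_minnP exg) => k /asboolP[x [Qx cx] xk] kmin.
have xmax y : Q y -> dot c y <= dot c x by rewrite cx; exact: x1max.
exists x; split => //.
have [xA x0] : affine_slice x /\ forall i, 0 <= x i 0 by rewrite QE in Qx.
pose z : 'cV[R]_m := \col_i (if x i 0 == 0 then -1 else 0).
have zE y : dot z y = - \sum_(i | x i 0 == 0) y i 0.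
  rewrite big_mkcond -sumrN; apply: eq_bigr => i _; rewrite mxE.
  by case: eqP => _; rewrite ?mulN1r// mul0r oppr0.
exists z, 0; split.
  move=> y; rewrite -/Q QE => -[_ y0]; rewrite zE oppr_le0.
  by apply: sumr_ge0 => i _; exact: y0.
apply/seteqP; split => [_ ->|y [Qy]].
  by split=> //; rewrite zE big1 ?oppr0// => i /eqP.
move=> /eqP; rewrite zE oppr_eq0 => /eqP ys; apply: contrapT => /eqP yx.
have [yA y0] : affine_slice y /\ forall i, 0 <= y i 0 by rewrite QE in Qy.
have yz i : x i 0 = 0 -> y i 0 = 0.
  by move/eqP; apply: (psumr_eq0P _ ys) => j _; exact: y0.
have [Ae e1] := affine_slice_sub xA yA.
have Ane : A *m - (y - x) = 0 by rewrite mulmxN Ae oppr0.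
have ne1 : \sum_i (- (y - x)) i 0 = 0.
  by under eq_bigr do rewrite mxE; rewrite sumrN e1 oppr0.
have xe i : x i 0 = 0 -> (y - x) i 0 = 0.
  by move=> xi; rewrite !mxE xi yz// subrr.
have xne i : x i 0 = 0 -> (- (y - x)) i 0 = 0.
  by move=> /xe xi; rewrite mxE xi oppr0.
have e0 : y - x != 0 by rewrite subr_eq0.
have ne0 : - (y - x) != 0 by rewrite oppr_eq0.
have [s [s0 sx _]] := ray_shrinks_support xA x0 Ane ne1 ne0 xne.
have [t [t0 tx tsupp]] := ray_shrinks_support xA x0 Ae e1 e0 xe.
have /xmax : Q (x + s *: - (y - x)).
  by rewrite QE; split=> //; exact: affine_slice_line.
have Qt : Q (x + t *: (y - x)).
  by rewrite QE; split=> //; exact: affine_slice_line.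
have := xmax _ Qt.
rewrite !dotDr !dotZr dotNr !gerDl !pmulr_rle0// oppr_le0 => ce ce'.
have ce0 : dot c (y - x) = 0 by apply/eqP; rewrite eq_le ce.
have : (k <= #|supp (x + t *: (y - x))|)%N.
  apply: kmin; apply/asboolP; exists (x + t *: (y - x)) => //.
  by rewrite dotDr dotZr ce0 mulr0 addr0.
by rewrite -xk leqNgt proper_card.
Qed.

End Polytope.

(** * Differentials of scalar functions *)

Section ScalarDifferential.
Context {R : realType}.

Lemma is_derive_is_diff (f : R -> R) (x df : R) :
  is_derive x 1 f df -> is_diff x f (fun h => h * df).
Proof.
move=> fd; have fdx : differentiable f x by apply/derivable1_diffP.
apply: DiffDef => //; rewrite diff1E//; apply/funext => h.
by rewrite derive1E (@derive_val _ _ _ _ _ _ _ fd).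
Qed.

Lemma is_diff_expR_comp (V : normedModType R) (f df : V -> R) x :
  is_diff x f df -> is_diff x (expR \o f) (fun h => df h * expR (f x)).
Proof.
move=> fd; exact: is_diff_comp fd (is_derive_is_diff (is_derive_expR (f x))).
Qed.

Lemma is_diff_ln_comp (V : normedModType R) (f df : V -> R) x :
  0 < f x -> is_diff x f df -> is_diff x (@ln R \o f) (fun h => df h / f x).
Proof.
move=> fx fd; exact: is_diff_comp fd (is_derive_is_diff (is_derive1_ln fx)).
Qed.

Lemma is_diff_inv_comp (V : normedModType R) (f df : V -> R) x :
  f x != 0 -> is_diff x f df ->
  is_diff x (fun y => (f y)^-1) (fun h => - df h / f x ^+ 2).
Proof.
move=> fx fd; apply: DiffDef; first exact: differentiableV.
rewrite diffV//; apply/funext => h /=.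
rewrite (@diff_val _ _ _ _ _ _ _ fd) -[LHS]/(- f x ^- 2 * df h).
by rewrite mulrC mulrN mulNr.
Qed.

Lemma is_diff_dot m (w x : 'cV[R]_m) : is_diff x (dot w) (dot w).
Proof.
have lin : linear (dot w : 'cV[R]_m -> R).
  by move=> k y z; rewrite dotDr dotZr.
pose dM := GRing.isLinear.Build _ _ _ _ _ lin.
pose dL : {linear 'cV[R]_m -> R} := HB.pack (dot w) dM.
have dc : continuous dL by exact: dot_continuous.
apply: DiffDef; first exact: (linear_differentiable x dc).
exact: (diff_lin x dc).
Qed.

End ScalarDifferential.

(** * Softmax weights and the parametrization *)

Lemma mulBlnB_ge0 (R : realType) (a b : R) :
  0 < a -> 0 < b -> 0 <= (a - b) * (ln a - ln b).
Proof.
move=> a0 b0; have [ab|/ltW ba] := leP a b.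
  by rewrite mulr_le0 ?subr_le0// ler_ln.
by rewrite mulr_ge0 ?subr_ge0// ler_ln.
Qed.

(** The index k0 witnesses that there is at least one vertex, so that the
    weights are positive and have sum 1. *)
Section SoftmaxParametrization.
Context {R : realType} {m d nP : nat}.
Variables (v : 'I_nP -> 'cV[R]_m) (G : 'M[R]_(m, d)) (k0 : 'I_nP).
Implicit Types (k : 'I_nP) (xi eta : 'cV[R]_d).

Definition expo k xi := dot (v k) (G *m xi).

Definition exp_sum xi := \sum_k expR (expo k xi).

Definition weight k xi := expR (expo k xi) / exp_sum xi.

Definition mean_expo xi eta := \sum_k weight k xi * expo k eta.

(** The directional derivative of the parametrization: the derivative of a
    softmax weight is the weight times the deviation of its exponent from the
    mean. *)
Definition dparam xi eta :=
  \sum_k (weight k xi * (expo k eta - mean_expo xi eta)) *: v k.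

Lemma exp_sum_gt0 xi : 0 < exp_sum xi.
Proof.
rewrite /exp_sum (bigD1 k0)//= ltr_pwDl ?expR_gt0//.
by apply: sumr_ge0 => k _; exact: expR_ge0.
Qed.

Lemma weight_gt0 k xi : 0 < weight k xi.
Proof. by rewrite divr_gt0 ?expR_gt0 ?exp_sum_gt0. Qed.

Lemma sum_weight xi : \sum_k weight k xi = 1.
Proof. by rewrite -mulr_suml divff// gt_eqF// exp_sum_gt0. Qed.

Lemma paramE xi : param v G xi = \sum_k weight k xi *: v k.
Proof.
rewrite /param scaler_sumr; apply: eq_bigr => k _.
by rewrite scalerA mulrC.
Qed.

Lemma param_coordE xi i : param v G xi i 0 = \sum_k weight k xi * v k i 0.
Proof. by rewrite paramE summxE; apply: eq_bigr => k _; rewrite mxE. Qed.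

Lemma dparam_coordE xi eta i : dparam xi eta i 0 =
  \sum_k (weight k xi * (expo k eta - mean_expo xi eta)) * v k i 0.
Proof. by rewrite summxE; apply: eq_bigr => k _; rewrite mxE. Qed.

Lemma expoB k xi eta : expo k (xi - eta) = expo k xi - expo k eta.
Proof. by rewrite /expo mulmxBr dotBr. Qed.

Lemma is_diff_expo k xi : is_diff xi (expo k) (expo k).
Proof.
apply: (eq_is_diff (g := dot (G^T *m v k)) (dg := dot (G^T *m v k))).
- by move=> eta; rewrite dot_mulmx trmxK.
- by move=> eta; rewrite dot_mulmx trmxK.
- exact: is_diff_dot.
Qed.

Lemma is_diff_weight k xi : is_diff xi (weight k)
  (fun eta => weight k xi * (expo k eta - mean_expo xi eta)).
Proof.
have Z0 : exp_sum xi != 0 by rewrite gt_eqF// exp_sum_gt0.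
have dE l : is_diff xi (fun y => expR (expo l y))
    (fun eta => expo l eta * expR (expo l xi)).
  exact: (is_diff_expR_comp (is_diff_expo l xi)).
have dZ := is_diff_inv_comp Z0 (is_diff_sum (index_enum 'I_nP) dE).
apply: eq_is_diff (is_diffM (dE k) dZ) => // eta.
have -> : mean_expo xi eta =
    (\sum_l expo l eta * expR (expo l xi)) / exp_sum xi.
  rewrite mulr_suml; apply: eq_bigr => l _.
  by rewrite /weight mulrAC [_ * expo _ _]mulrC.
rewrite /weight /= !fctE /=.
rewrite -[RHS]/(expR (expo k xi) *
    (- (\sum_l expo l eta * expR (expo l xi)) / exp_sum xi ^+ 2) +
    (exp_sum xi)^-1 * (expo k eta * expR (expo k xi))).
by field.
Qed.

Lemma is_diff_param_coord xi i :
  is_diff xi (fun y => param v G y i 0) (fun eta => dparam xi eta i 0).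
Proof.
have dw k : is_diff xi (fun y => weight k y * v k i 0)
    (fun eta => (weight k xi * (expo k eta - mean_expo xi eta)) * v k i 0).
  apply: eq_is_diff (is_diffZ (v k i 0) (is_diff_weight k xi)) => y;
  by rewrite [RHS]mulrC.
apply: eq_is_diff (is_diff_sum (index_enum 'I_nP) dw) => y.
  exact: param_coordE.
exact: dparam_coordE.
Qed.

Lemma weight_continuous k : continuous (weight k).
Proof.
by move=> xi; apply: differentiable_continuous; have := is_diff_weight k xi.
Qed.

Lemma param_coord_continuous i : continuous (fun xi => param v G xi i 0).
Proof.
move=> xi; apply: differentiable_continuous.
by have := is_diff_param_coord xi i.
Qed.

Lemma dparam_coord_continuous eta i : continuous (fun xi => dparam xi eta i 0).
Proof.
move=> xi; apply: eq_continuous_at => [y|]; first exact: dparam_coordE.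
apply: sum_continuous_at => k.
apply: continuousM; last exact: cst_continuous_at.
apply: continuousM; first exact: weight_continuous.
apply: continuousB; first exact: cst_continuous_at.
apply: sum_continuous_at => l.
apply: continuousM; first exact: weight_continuous.
exact: cst_continuous_at.
Qed.

Lemma dot_param xi y : dot (param v G xi) y = \sum_k weight k xi * dot (v k) y.
Proof.
rewrite paramE dotC dot_sumr; apply: eq_bigr => k _.
by rewrite dotZr dotC.
Qed.

Lemma mean_expoE xi eta : dot (param v G xi) (G *m eta) = mean_expo xi eta.
Proof. by rewrite dot_param. Qed.

Lemma sum_dweight xi eta :
  \sum_k weight k xi * (expo k eta - mean_expo xi eta) = 0.
Proof.
under eq_bigr do rewrite mulrBr.
by rewrite sumrB -mulr_suml sum_weight mul1r subrr.
Qed.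

(** The dot product of [dparam xi eta] with G eta is the variance of the
    exponents v^k . G eta under the weights, which is 0 only if they are all
    equal. *)
Lemma dparam_eq0 xi eta :
  dparam xi eta = 0 -> forall k, expo k eta = mean_expo xi eta.
Proof.
move=> dp k.
have : \sum_l weight l xi * (expo l eta - mean_expo xi eta) ^+ 2 = 0.
  transitivity (dot (dparam xi eta) (G *m eta)); last first.
    by rewrite dp dotC dot0r.
  rewrite dotC dot_sumr.
  transitivity (\sum_l
    (weight l xi * (expo l eta - mean_expo xi eta) * expo l eta
     - weight l xi * (expo l eta - mean_expo xi eta) * mean_expo xi eta)).
    by apply: eq_bigr => l _; ring.
  rewrite sumrB -mulr_suml sum_dweight mul0r subr0.
  by apply: eq_bigr => l _; rewrite dotZr [dot (G *m _) _]dotC.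
move=> /psumr_eq0P H.
have /eqP : weight k xi * (expo k eta - mean_expo xi eta) ^+ 2 = 0.
  by apply: H => // l _; rewrite mulr_ge0 ?sqr_ge0// ltW// weight_gt0.
by rewrite mulf_eq0 gt_eqF ?weight_gt0//= sqrf_eq0 subr_eq0 => /eqP.
Qed.

Lemma ln_weight k xi : ln (weight k xi) = expo k xi - ln (exp_sum xi).
Proof. by rewrite ln_div ?posrE ?expR_gt0 ?exp_sum_gt0// expRK. Qed.

(** Let w and u be the weights at xi and xi'.  Up to an additive constant, the
    exponents at xi and xi' are ln w and ln u, so that (p(xi) - p(xi')) .
    G (xi - xi') is the sum of the nonnegative terms (w_k - u_k)
    (ln w_k - ln u_k).  If it vanishes, then w = u. *)
Lemma param_eq xi xi' : param v G xi = param v G xi' ->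
  exists c, forall k, expo k (xi - xi') = c.
Proof.
move=> pp; exists (ln (exp_sum xi) - ln (exp_sum xi')) => k.
have /psumr_eq0P H : \sum_l (weight l xi - weight l xi') *
    (ln (weight l xi) - ln (weight l xi')) = 0.
  transitivity (dot (param v G xi - param v G xi') (G *m (xi - xi')) -
     (\sum_l weight l xi - \sum_l weight l xi') *
     (ln (exp_sum xi) - ln (exp_sum xi'))).
    rewrite dotC dotBr !(dotC (G *m _)) !dot_param -!sumrB mulr_suml -sumrB.
    apply: eq_bigr => l _; rewrite !ln_weight.
    by rewrite -/(expo l (xi - xi')) expoB; ring.
  by rewrite !sum_weight pp !subrr mul0r dotC dot0r subr0.
have /eqP : (weight k xi - weight k xi') *
    (ln (weight k xi) - ln (weight k xi')) = 0.
  by apply: H => // l _; apply: mulBlnB_ge0; exact: weight_gt0.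
rewrite mulf_eq0 => lnE.
have /eqP : ln (weight k xi) - ln (weight k xi') = 0.
  by case/orP: lnE => /eqP // /subr0_eq ->; rewrite subrr.
by rewrite !ln_weight expoB; lra.
Qed.

(** The difference of the two dot products is the weighted mean of the gaps
    t_l = expo k - expo l.  A positive gap carries a weight at most exp (- t_l),
    and t exp (- t) <= 1, so each of the n_P terms is at most 1. *)
Lemma expo_le_param k xi :
  expo k xi <= dot (param v G xi) (G *m xi) + nP%:R.
Proof.
rewrite mean_expoE -lerBlDl.
have -> : expo k xi - mean_expo xi xi =
    \sum_l weight l xi * (expo k xi - expo l xi).
  under [RHS]eq_bigr do rewrite mulrBr.
  by rewrite sumrB -mulr_suml sum_weight mul1r.
rewrite -[nP in leRHS]card_ord -sum1_card natr_sum; apply: ler_sum => l _.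
have [kl|/ltW lk] := leP (expo k xi) (expo l xi).
  by rewrite (@le_trans _ _ 0)// mulr_ge0_le0 ?subr_le0// ltW// weight_gt0.
apply: (@le_trans _ _ (expR (expo l xi) / expR (expo k xi) *
    (expo k xi - expo l xi))).
  rewrite ler_wpM2r ?subr_ge0// ler_pM2l ?expR_gt0//.
  rewrite lef_pV2 ?posrE ?expR_gt0 ?exp_sum_gt0//.
  rewrite /exp_sum (bigD1 k)//= lerDl.
  by apply: sumr_ge0 => j _; exact: expR_ge0.
rewrite -expRB -opprB expRN mulrC ler_pdivrMr ?expR_gt0// mul1r.
by have := expR_ge1Dx (expo k xi - expo l xi); lra.
Qed.

End SoftmaxParametrization.

(** * The parametrization maps properly into the polytope *)

Section PolytopeParametrization.
Context {R : realType} {l m d nP : nat} (A : 'M[R]_(l, m)).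
Variables (v : 'I_nP -> 'cV[R]_m) (G : 'M[R]_(m, d)).
Hypothesis P_neq0 : coef_polytope A !=set0.
Let Q := closed_coef_polytope A.
Hypothesis v_vertices : range v = [set x | is_vertex Q x].
Hypothesis GT : forall eta : 'cV[R]_d,
  A *m (G *m eta) = 0 /\ \sum_i (G *m eta) i 0 = 0.
Hypothesis GG : G^T *m G = 1%:M.

Let QE : Q = [set x | affine_slice A x /\ forall i, 0 <= x i 0].
Proof. exact: closed_coef_polytopeE. Qed.

Lemma vertex_in k : Q (v k).
Proof.
have : is_vertex Q (v k).
  rewrite -[is_vertex Q _]/([set x | is_vertex Q x] (v k)) -v_vertices.
  by exists k.
by move=> [c [b [_ e]]]; have : [set v k] (v k) by []; rewrite e => -[].
Qed.

Lemma max_at_v c x : Q x -> exists k, dot c x <= dot c (v k).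
Proof.
move=> Qx; have [w [wv wmax]] := max_at_vertex P_neq0 c.
have : range v w by rewrite v_vertices.
by move=> [k _ kw]; exists k; rewrite kw; exact: wmax.
Qed.

Lemma some_vertex : 'I_nP.
Proof.
have [p Pp] := cid P_neq0; have Qp : Q p by exact: subset_closure.
by have [k _] := cid (max_at_v 0 Qp).
Qed.

Let k0 := some_vertex.

Lemma param_polytope xi :
  affine_slice A (param v G xi) /\ forall i, 0 < param v G xi i 0.
Proof.
have Qv k : affine_slice A (v k) /\ forall i, 0 <= v k i 0.
  by have := @vertex_in k; rewrite QE.
split; first split.
- rewrite paramE mulmx_sumr big1// => k _.
  by rewrite -scalemxAr (Qv k).1.1 scaler0.
- under eq_bigr do rewrite param_coordE.
  rewrite exchange_big /= -[RHS](sum_weight v G k0 xi); apply: eq_bigr => k _.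
  by rewrite -mulr_sumr (Qv k).1.2 mulr1.
move=> i; have [p Pp] := P_neq0; have Qp : Q p by exact: subset_closure.
have p0 : 0 < p i 0 by move: Pp; rewrite coef_polytopeE => -[].
have [k] := max_at_v (delta_mx i 0) Qp; rewrite !dot_delta => pk.
rewrite param_coordE (bigD1 k)//= ltr_pwDl//.
  by rewrite mulr_gt0 ?weight_gt0// (lt_le_trans p0).
apply: sumr_ge0 => j _; rewrite mulr_ge0//; last exact: (Qv j).2.
by rewrite ltW// weight_gt0.
Qed.

Lemma dot_G eta : dot (G *m eta) (G *m eta) = dot eta eta.
Proof. by rewrite dot_mulmx mulmxA GG mul1mx. Qed.

(** All coordinates of x being at least e, the point x + e G eta / |eta| is
    still in the polytope, and some vertex is at least as high in the direction
    of G eta. *)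
Lemma expo_bound x eta e : Q x -> (forall i, e <= x i 0) -> 0 < e ->
  exists k, dot x (G *m eta) + e * Num.sqrt (dot eta eta) <= expo v G k eta.
Proof.
move=> Qx xe e0; set g := G *m eta; set N := Num.sqrt (dot eta eta).
have [N0|N0] := eqVneq N 0.
  have [k kx] := max_at_v g Qx; exists k; rewrite N0 mulr0 addr0.
  by rewrite dotC (le_trans kx)// /expo dotC.
have Npos : 0 < N by rewrite lt_neqAle sqrtr_ge0 eq_sym N0.
have [xA x0] : affine_slice A x /\ forall i, 0 <= x i 0 by rewrite QE in Qx.
have Qy : Q (x + (e / N) *: g).
  rewrite QE; split=> [|i].
    by have [? ?] := GT eta; exact: affine_slice_line.
  have gN : `|g i 0| <= N by rewrite /N -dot_G; exact: coord_le_sqrt_dot.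
  have -> : (x + (e / N) *: g) i 0 = x i 0 + e / N * g i 0 by rewrite 2!mxE.
  have : - e <= e / N * g i 0.
    rewrite mulrAC -lerNl -mulNr ler_pdivrMr// -mulrN ler_pM2l//.
    by move: gN; rewrite ler_norml => /andP[]; lra.
  by have := xe i; lra.
have [k kx] := max_at_v g Qy; exists k.
move: kx; rewrite dotDr dotZr dot_G [dot g x]dotC /expo [dot (v k) _]dotC.
have -> // : e / N * dot eta eta = e * N.
by rewrite -[dot eta eta]sqr_sqrtr ?dot_ge0// -/N; field.
Qed.

(** The linear functional G eta then takes the value c at p(0) too.  But p(0)
    can be moved inside the polytope in the direction of G eta, and no vertex
    is higher than c in this direction; hence eta = 0. *)
Lemma expo_const_eq0 eta c : (forall k, expo v G k eta = c) -> eta = 0.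
Proof.
move=> H; pose p := param v G 0.
have [pA p0] := param_polytope 0.
have Qp : Q p by rewrite QE; split => // i; exact: ltW.
have [e e0 pe] : exists2 e, 0 < e & forall i, e <= p i 0.
  pose e := \big[Num.min/1]_i p i 0.
  exists e; first by apply: lt_bigmin => // i _; exact: p0.
  by move=> i; exact: bigmin_le.
have [k] := expo_bound eta Qp pe e0.
rewrite H mean_expoE /mean_expo; under eq_bigr do rewrite H.
rewrite -mulr_suml (sum_weight v G k0) mul1r gerDl pmulr_rle0// => N0.
have : Num.sqrt (dot eta eta) = 0 by apply/eqP; rewrite eq_le N0 sqrtr_ge0.
move=> /eqP; rewrite sqrtr_eq0 => E.
by apply: dot_eq0; apply/eqP; rewrite eq_le E dot_ge0.
Qed.

Lemma param_inj : injective (param v G).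
Proof.
move=> xi xi' /(param_eq k0)[c /expo_const_eq0 E].
by apply/eqP; rewrite -subr_eq0 E.
Qed.

Lemma dparam_inj xi eta : dparam v G xi eta = 0 -> eta = 0.
Proof. by move=> /(dparam_eq0 k0)/expo_const_eq0. Qed.

(** By [expo_bound] some exponent exceeds p(xi) . G xi by e |xi|, and by
    [expo_le_param] none exceeds it by more than n_P. *)
Lemma param_proper e xi : 0 < e -> (forall i, e <= param v G xi i 0) ->
  `|xi| <= nP%:R / e.
Proof.
move=> e0 pe; have [pA p0] := param_polytope xi.
have Qp : Q (param v G xi) by rewrite QE; split => // i; exact: ltW.
have [k pk] := expo_bound xi Qp pe e0.
have N : Num.sqrt (dot xi xi) <= nP%:R / e.
  rewrite ler_pdivlMr// mulrC.
  by have := expo_le_param v G k0 k xi; move: pk; lra.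
apply: norm_le_coord => [|i]; first by rewrite divr_ge0// ltW.
exact: le_trans (coord_le_sqrt_dot xi i) N.
Qed.

End PolytopeParametrization.

(** * Sign vectors *)

Section SignVectors.
Context {R : realType} {m : nat}.
Implicit Types x y : 'cV[R]_m.

Lemma sign_vector_eq0 x : sign_vector x = 0 -> x = 0.
Proof.
move=> sx; apply/colP => i; move/colP/(_ i)/eqP : sx.
by rewrite !mxE sgz_eq0 => /eqP.
Qed.

Lemma eq_sign_vector x y :
  (forall i, sgz (x i 0) = sgz (y i 0)) -> sign_vector x = sign_vector y.
Proof. by move=> xy; apply/colP => i; rewrite !mxE. Qed.

Lemma sgz_ln_sub (a b : R) : 0 < a -> 0 < b -> sgz (ln a - ln b) = sgz (a - b).
Proof.
move=> a0 b0; have [ab|ba|->] := ltgtP a b; last by rewrite !subrr.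
  by rewrite !ltr0_sgz ?subr_lt0// ltr_ln.
by rewrite !gtr0_sgz ?subr_gt0// ltr_ln.
Qed.

End SignVectors.

(** * Logarithms of monomials *)

Section LogCoordinates.
Context {R : realType} {m d : nat}.
Variable H : 'M[R]_(m, d).

Definition log_monomials (x : 'cV[R]_m) : 'cV[R]_d :=
  H^T *m (\col_i ln (x i 0)).

Lemma monomialsE (x : 'cV[R]_m) : (forall i, 0 < x i 0) ->
  monomials x H = \col_j expR (log_monomials x j 0).
Proof.
move=> x0; apply/colP => j; rewrite !mxE expR_sum; apply: eq_bigr => i _.
by rewrite /powR gt_eqF// !mxE.
Qed.

Lemma dot_log_monomials c x :
  dot c (log_monomials x) = \sum_i (H *m c) i 0 * ln (x i 0).
Proof. by rewrite -dot_mulmx; apply: eq_bigr => i _; rewrite mxE. Qed.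

End LogCoordinates.

(** * Log-monomials blow up at the boundary *)

(** Near x, the terms with x_i > 0 are bounded by continuity, those with
    x_i = 0 are at most 0 because y_i < 1 and z_i >= 0, and the term at i1 tends
    to minus infinity. *)
Lemma log_sum_near_boundary (R : realType) m (x z : 'cV[R]_m) i1 M :
  (forall i, 0 <= x i 0) -> x i1 0 = 0 -> 0 < z i1 0 ->
  (forall i, x i 0 = 0 -> 0 <= z i 0) ->
  \forall y \near x, (forall i, 0 < (y : 'cV[R]_m) i 0) ->
    \sum_i z i 0 * ln (y i 0) < M.
Proof.
move=> x0 xi1 zi1 zI.
pose b i := if x i 0 == 0 then 0 else `|z i 0| * (`|ln (x i 0)| + 1).
pose S := \sum_i b i.
have b0 i : 0 <= b i.
  by rewrite /b; case: eqP => // _; rewrite mulr_ge0 ?addr_ge0.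
have H1 : \forall y \near x, forall i, i != i1 -> 0 < (y : 'cV[R]_m) i 0 ->
    z i 0 * ln (y i 0) <= b i.
  refine (@filter_forall _ _ _ (nbhs x) _ _) => i; rewrite /b.
  case: (eqVneq (x i 0) 0) => xi.
    have : \forall y \near x, (y : 'cV[R]_m) i 0 < 1.
      apply: (cvgr_lt (x i 0) (@coord_continuous _ _ _ i 0 x)).
      by rewrite xi.
    apply: filterS => y y1 _ y0.
    by rewrite mulr_ge0_le0 ?zI// ln_le0// ltW.
  have xp : 0 < x i 0 by rewrite lt_neqAle x0 andbT eq_sym.
  have lnc : {for x, continuous (fun y : 'cV[R]_m => `|ln (y i 0)|)}.
    apply: (@continuous_comp _ _ _ (fun y : 'cV[R]_m => ln (y i 0)) Num.norm).
      apply: (@continuous_comp _ _ _ (fun y : 'cV[R]_m => y i 0) (@ln R)).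
        exact: coord_continuous.
      exact: continuous_ln.
    exact: norm_continuous.
  have : \forall y \near x, `|ln ((y : 'cV[R]_m) i 0)| < `|ln (x i 0)| + 1.
    by apply: (cvgr_lt _ lnc); rewrite ltrDl.
  apply: filterS => y ylt _ _.
  rewrite (le_trans (ler_norm _))// normrM ler_wpM2l//.
  exact: ltW.
have H2 : \forall y \near x, (y : 'cV[R]_m) i1 0 < expR ((M - S) / z i1 0).
  apply: (cvgr_lt (x i1 0) (@coord_continuous _ _ _ i1 0 x)).
  by rewrite xi1 expR_gt0.
near=> y => y0.
have yb : forall i, i != i1 -> 0 < y i 0 -> z i 0 * ln (y i 0) <= b i.
  by near: y.
rewrite (bigD1 i1)//=.
have : \sum_(i < m | i != i1) z i 0 * ln (y i 0) <= S.
  apply: (@le_trans _ _ (\sum_(i < m | i != i1) b i)).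
    by apply: ler_sum => i ii1; exact: yb.
  by rewrite /S [leRHS](bigD1 i1)//= lerDr.
have : z i1 0 * ln (y i1 0) < M - S.
  rewrite mulrC -ltr_pdivlMr// -[ltRHS]expRK ltr_ln ?posrE ?expR_gt0//.
  by near: y.
lra.
Unshelve. all: by end_near. Qed.

Section BoundaryBlowup.
Context {R : realType} {l m d : nat} (A : 'M[R]_(l, m)) (H : 'M[R]_(m, d)).
Hypothesis P_neq0 : coef_polytope A !=set0.
Let Q := closed_coef_polytope A.

Let QE : Q = [set x | affine_slice A x /\ forall i, 0 <= x i 0].
Proof. exact: closed_coef_polytopeE. Qed.

(** The functional exposing this face is minus the sum of the coordinates in the
    zero set of x. *)
Lemma face_of_zeros x : Q x ->
  let f := [set y | Q y /\ forall i, x i 0 = 0 -> y i 0 = 0] in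
  [/\ is_face Q f, f x & forall i, face_sign f i 0 = (x i 0 == 0)%:R].
Proof.
move=> Qx f; split=> [||i]; last 2 first.
- by [].
- rewrite mxE; case: eqP => xi; case: asboolP => //.
    by case=> y [_ yx]; exact: yx.
  by move=> fi; case: xi; apply: fi.
exists (\col_i (- (x i 0 == 0)%:R)), 0.
have zE y : dot (\col_i (- (x i 0 == 0)%:R)) y = - \sum_(i | x i 0 == 0) y i 0.
  rewrite big_mkcond -sumrN; apply: eq_bigr => i _; rewrite mxE.
  by case: eqP => _; rewrite ?mulN1r// oppr0 mul0r.
split=> [y|].
  rewrite QE => -[_ y0]; rewrite zE oppr_le0.
  by apply: sumr_ge0 => i _; exact: y0.
apply/seteqP; split=> y [Qy]; rewrite /= zE => yx; split => //.
  by rewrite big1 ?oppr0// => i /eqP; exact: yx.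
move=> i /eqP; have y0 : forall j, 0 <= y j 0.
  by move: (Qy); rewrite -/Q QE => -[].
move/eqP: yx; rewrite oppr_eq0 => /eqP ys.
by apply: (psumr_eq0P _ ys) => j _; exact: y0.
Qed.

Hypothesis face_condition : forall f : set 'cV[R]_m,
  is_face Q f -> f !=set0 -> f <> Q ->
  forall y, H^T *m y = 0 -> sign_vector y <> face_sign f.

(** By compactness of the closed polytope it suffices to work near each of its
    points x.  If x has positive coordinates, half of them bounds the
    coordinates nearby.  Otherwise no point of P near x satisfies the bound on
    the log-monomials: the second Stiemke alternative is excluded by the
    condition on faces, and the first one provides z = H c such that
    the sum of the z_i ln y_i, equal to c paired with the log-monomials of y,
    is arbitrarily negative. *)
Lemma log_monomials_bounded M : exists2 e, 0 < e &
  forall x, coef_polytope A x -> `|log_monomials H x| <= M ->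
  forall i, e <= x i 0.
Proof.
pose bounded_below e (x : 'cV[R]_m) := (forall i, 0 < x i 0) ->
  `|log_monomials H x| <= M -> forall i, e <= x i 0.
have cQ : compact Q by rewrite QE; exact: compact_polytope_ineq.
suff He : \forall e \near (0 : R)^'+, Q `<=` bounded_below e.
  near (0 : R)^'+ => e; exists e => // x Px.
  have /(_ x) : Q `<=` bounded_below e by near: e.
  apply; first exact: subset_closure.
  by move: Px; rewrite coef_polytopeE => -[].
apply: ((compact_near_coveringP Q).1 cQ) => x Qx.
have [xA x0] : affine_slice A x /\ forall i, 0 <= x i 0.
  by move: (Qx); rewrite QE.
have [xpos|/existsNP[i0 /negP]] := pselect (forall i, 0 < x i 0).
  exists ([set y : 'cV[R]_m | forall i, x i 0 / 2 <= y i 0],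
          [set e | forall i, e <= x i 0 / 2]).
    split=> /=.
      refine (@filter_forall _ _ _ (nbhs x) _ _) => i.
      apply: (cvgr_ge (x i 0) (@coord_continuous _ _ _ i 0 x)).
      by rewrite ltr_pdivrMr// ltr_pMr// ltr1n.
    refine (@filter_forall _ _ _ ((0 : R)^'+) _ _) => i.
    by apply: nbhs_right_le; rewrite divr_gt0.
  by move=> [y e] [/= yx ex] _ _ i; exact: le_trans (ex i) (yx i).
rewrite lt_neqAle x0 andbT negbK eq_sym => /eqP xi0.
have [ff fx fs] := face_of_zeros Qx.
set f := [set y | Q y /\ _] in ff fx fs.
have fQ : f <> Q.
  move=> fQ; have [p Pp] := P_neq0.
  have : f p by rewrite fQ; exact: subset_closure.
  move=> [_ /(_ _ xi0)]; move: Pp; rewrite coef_polytopeE => -[_ /(_ i0)].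
  by move=> /[swap] ->; rewrite ltxx.
have [[c [cI [i1 i1I ci1]]]|[y [Hy yI yN]]] :=
  stiemke_alternative H [pred i | x i 0 == 0].
  set z := H *m c in cI ci1.
  have lt := @log_sum_near_boundary _ _ x z i1 (- (\sum_i `|c i 0| * M))
    x0 (eqP i1I) ci1.
  have {}lt := lt (fun i xi => cI i (introT eqP xi)).
  near=> y e => y0 yM; exfalso.
  have ylt : (forall i, 0 < y i 0) ->
      \sum_i z i 0 * ln (y i 0) < - (\sum_i `|c i 0| * M) by near: y.
  move: (ylt y0); apply/negP.
  rewrite -leNgt -dot_log_monomials lerNl -mulr_suml.
  rewrite -dotNr (le_trans (dot_le_norm _ _))// normrN.
  by rewrite ler_wpM2l// sumr_ge0.
have := face_condition ff (ex_intro _ x fx) fQ Hy; case.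
apply/colP => i; rewrite fs mxE.
have [xi|xi] := boolP (x i 0 == 0); first by rewrite gtr0_sgz// yI.
by rewrite yN// sgz0.
Unshelve. all: by end_near. Qed.

End BoundaryBlowup.

(** * The monomial map is a diffeomorphism *)

Lemma unitmx_inj (F : fieldType) n (M : 'M[F]_n) :
  (forall x : 'cV[F]_n, M *m x = 0 -> x = 0) -> M \in unitmx.
Proof.
move=> Minj; rewrite -unitmx_tr -row_free_unit -kermx_eq0.
apply/eqP/row_matrixP => i; rewrite row0; apply: trmx_inj; rewrite trmx0.
apply: Minj; apply: trmx_inj.
by rewrite trmx_mul trmxK trmx0 -row_mul mulmx_ker row0.
Qed.

Lemma col_jacobian_unit (R : realType) d (f : 'cV[R]_d -> 'cV[R]_d) df xi :
  is_diff xi f df -> (forall eta, df eta = 0 -> eta = 0) ->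
  col_jacobian f xi \in unitmx.
Proof.
move=> fd dfi; apply: unitmx_inj => eta.
by rewrite -col_jacobianE (@diff_val _ _ _ _ _ _ _ fd) => /dfi.
Qed.

Lemma open_positive_orthant (R : realType) n : open (@positive_orthant R n).
Proof.
rewrite openE => y y0; rewrite /interior.
suff : \forall z \near y, forall i, 0 < (z : 'cV[R]_n) i 0 by [].
refine (@filter_forall _ _ _ (nbhs y) _ _) => i.
by apply: (cvgr_gt (y i 0) (@coord_continuous _ _ _ i 0 y)); exact: y0.
Qed.

(** The orthogonal complement of D being the kernel of H^T, [sign_condition] and
    [face_condition] are the forms of conditions (i) and (ii) in which the
    arguments use them. *)
Section LogMap.
Context {R : realType} {l m d nP : nat} (A : 'M[R]_(l, m)).
Variables (v : 'I_nP -> 'cV[R]_m) (G H : 'M[R]_(m, d)).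
Hypothesis P_neq0 : coef_polytope A !=set0.
Let Q := closed_coef_polytope A.
Hypothesis v_vertices : range v = [set x | is_vertex Q x].
Hypothesis GT : forall eta : 'cV[R]_d,
  A *m (G *m eta) = 0 /\ \sum_i (G *m eta) i 0 = 0.
Hypothesis GG : G^T *m G = 1%:M.
Hypothesis sign_condition : forall y t : 'cV[R]_m, H^T *m y = 0 ->
  A *m t = 0 -> \sum_i t i 0 = 0 -> sign_vector y = sign_vector t -> t = 0.
Hypothesis face_condition : forall f : set 'cV[R]_m,
  is_face Q f -> f !=set0 -> f <> Q ->
  forall y, H^T *m y = 0 -> sign_vector y <> face_sign f.

Let p := param v G.
Let dp := dparam v G.
Let k0 : 'I_nP := some_vertex P_neq0 v_vertices.

Let p_gt0 xi i : 0 < p xi i 0.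
Proof. exact: (param_polytope G P_neq0 v_vertices xi).2. Qed.

Lemma dparam_direction xi eta :
  A *m dp xi eta = 0 /\ \sum_i dp xi eta i 0 = 0.
Proof.
have vA k : affine_slice A (v k).
  have := @vertex_in _ _ _ _ _ _ v_vertices k.
  by rewrite closed_coef_polytopeE// => -[].
split.
  by rewrite mulmx_sumr big1// => k _; rewrite -scalemxAr (vA k).1 scaler0.
rewrite -[RHS](sum_dweight v G k0 xi eta).
under eq_bigr do rewrite dparam_coordE.
rewrite exchange_big /=; apply: eq_bigr => k _.
by rewrite -mulr_sumr (vA k).2 mulr1.
Qed.

Definition logmap xi := log_monomials H (p xi).

Definition dlogmap xi eta := H^T *m \col_i (dp xi eta i 0 / p xi i 0).

Lemma is_diff_logmap xi : is_diff xi logmap (dlogmap xi).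
Proof.
have dln : is_diff xi (fun y => \col_i ln (p y i 0) : 'cV[R]_m)
    (fun eta => \col_i (dp xi eta i 0 / p xi i 0)).
  apply: is_diff_col => i.
  have dpi := is_diff_param_coord v G k0 xi i.
  by apply: eq_is_diff (is_diff_ln_comp (p_gt0 xi i) dpi) => y; rewrite mxE.
exact: is_diff_comp dln (is_diff_mulmx H^T _).
Qed.

(** The vector dp / p is in the kernel of H^T and has the signs of dp, which is
    a direction of the affine hull of the polytope. *)
Lemma dlogmap_inj xi eta : dlogmap xi eta = 0 -> eta = 0.
Proof.
move=> dl; apply: (dparam_inj P_neq0 v_vertices GT GG (xi := xi)).
have [Ad d0] := dparam_direction xi eta.
apply: sign_condition dl Ad d0 _; apply: eq_sign_vector => i.
by rewrite mxE sgzM [sgz _^-1]gtr0_sgz ?mulr1// invr_gt0.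
Qed.

(** The vector ln p(xi) - ln p(xi') is in the kernel of H^T and has the signs of
    p(xi) - p(xi'), which is a direction of the affine hull of the polytope. *)
Lemma logmap_inj : injective logmap.
Proof.
move=> xi xi' xx; apply: (param_inj P_neq0 v_vertices GT GG).
have [Ad d0] := affine_slice_sub (param_polytope G P_neq0 v_vertices xi').1
                                 (param_polytope G P_neq0 v_vertices xi).1.
apply/eqP; rewrite -subr_eq0; apply/eqP.
apply: (sign_condition (y := \col_i (ln (p xi i 0) - ln (p xi' i 0)))) Ad d0 _.
  have -> : \col_i (ln (p xi i 0) - ln (p xi' i 0)) =
      (\col_i ln (p xi i 0)) - (\col_i ln (p xi' i 0)) :> 'cV[R]_m.
    by apply/colP => i; rewrite !mxE.
  by rewrite mulmxBr; apply/eqP; rewrite subr_eq0; apply/eqP.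
apply: eq_sign_vector => i; rewrite mxE sgz_ln_sub//; congr sgz.
by rewrite [RHS]mxE [X in _ = _ + X]mxE.
Qed.

Lemma logmap_proper : proper_map logmap.
Proof.
move=> M; have [e e0 He] := log_monomials_bounded P_neq0 face_condition M.
exists (nP%:R / e) => xi xiM.
apply: (param_proper P_neq0 v_vertices GT GG e0); apply: He => //.
by rewrite coef_polytopeE; exact: param_polytope.
Qed.

Let F := Fmap v G H.

Lemma FmapE xi : F xi = \col_j expR (logmap xi j 0).
Proof. exact: monomialsE. Qed.

Definition dFmap xi eta : 'cV[R]_d :=
  \col_j (dlogmap xi eta j 0 * expR (logmap xi j 0)).

Lemma is_diff_Fmap xi : is_diff xi F (dFmap xi).
Proof.
apply: is_diff_col => j.
have dj : is_diff xi (fun y => logmap y j 0) (fun eta => dlogmap xi eta j 0).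
  apply: (eq_is_diff (g := dot (delta_mx j 0) \o logmap)
     (dg := dot (delta_mx j 0) \o dlogmap xi)) => [y|y|].
  - by rewrite /= dot_delta.
  - by rewrite /= dot_delta.
  - exact: is_diff_comp (is_diff_logmap xi) (is_diff_dot _ _).
by apply: eq_is_diff (is_diff_expR_comp dj) => y; rewrite ?FmapE mxE.
Qed.

Lemma logmap_continuous : continuous logmap.
Proof.
by move=> xi; apply: differentiable_continuous; have := is_diff_logmap xi.
Qed.

Lemma Fmap_C1 : C1_on setT F.
Proof.
apply: (C1_on_is_diff openT (fun xi _ => is_diff_Fmap xi)) => xi eta j _.
apply: eq_continuous_at => [y|]; first by rewrite mxE.
apply: continuousM; last first.
  apply: (@continuous_comp _ _ _ (fun y => logmap y j 0) (@expR R)).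
    by apply: coord_continuous_at; exact: logmap_continuous.
  exact: continuous_expR.
apply: eq_continuous_at => [y|]; first by rewrite mxE.
apply: sum_continuous_at => i.
apply: continuousM; first exact: cst_continuous_at.
apply: (eq_continuous_at (g := fun y => dp y eta i 0 * (p y i 0)^-1)) => [y|].
  by rewrite mxE.
apply: continuousM.
  exact: (@dparam_coord_continuous _ _ _ _ v G k0 eta i xi).
apply: continuousV; first by rewrite gt_eqF ?p_gt0.
exact: (@param_coord_continuous _ _ _ _ v G k0 i xi).
Qed.

Lemma dFmap_inj xi eta : dFmap xi eta = 0 -> eta = 0.
Proof.
move=> /colP dF; apply: (@dlogmap_inj xi); apply/colP => j.
have /eqP := dF j; rewrite mxE [X in _ == X]mxE mulf_eq0 expR_eq0 orbF.
by move=> /eqP ->; rewrite mxE.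
Qed.

(** The inverse of F is the inverse of [logmap] after the coordinatewise
    logarithm; it is continuous, and C1 because F is C1 with invertible
    Jacobian. *)
Lemma Fmap_diffeomorphism : diffeomorphism setT (positive_orthant d) F.
Proof.
have ld xi : differentiable logmap xi by have := is_diff_logmap xi.
have lu xi : col_jacobian logmap xi \in unitmx.
  exact: col_jacobian_unit (is_diff_logmap xi) (@dlogmap_inj xi).
have [g0 g0K] := choice (proper_regular_surjective ld lu logmap_proper).
have g0c : continuous g0.
  exact: proper_injective_inverse_continuous logmap_continuous logmap_inj
    logmap_proper g0K.
pose g (y : 'cV[R]_d) := g0 (\col_j ln (y j 0)).
have gF x : g (F x) = x.
  apply: logmap_inj; rewrite /g g0K; apply/colP => j.
  by rewrite mxE FmapE mxE expRK.
have Fg y : positive_orthant d y -> F (g y) = y.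
  move=> y0; apply/colP => j.
  by rewrite FmapE mxE /g g0K mxE lnK// posrE; exact: y0.
split; [split|exact: Fmap_C1|exists g => //].
- by move=> x _ j; rewrite FmapE mxE expR_gt0.
- by move=> x y _ _ xy; rewrite -(gF x) xy gF.
- by move=> y y0; exists (g y) => //; exact: Fg.
apply: (inverse_C1 (@open_positive_orthant R d) Fmap_C1 _ Fg) => [x|y y0].
  exact: col_jacobian_unit (is_diff_Fmap x) (@dFmap_inj x).
apply: (@continuous_comp _ _ _
  (fun y : 'cV[R]_d => \col_j ln (y j 0) : 'cV[R]_d) g0).
  apply: mx_continuous_at => j k.
  apply: eq_continuous_at => [z|]; first by rewrite mxE.
  apply: (@continuous_comp _ _ _ (fun y : 'cV[R]_d => y j 0) (@ln R)).
    exact: coord_continuous.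
  by apply: continuous_ln; exact: y0.
exact: g0c.
Qed.

End LogMap.

Lemma orthogonal_complement_span (R : realType) m d (D : {vspace 'cV[R]_m})
    (H : 'M[R]_(m, d)) y :
  basis_of D [tuple col j H | j < d] -> H^T *m y = 0 ->
  orthogonal_complement D y.
Proof.
move=> Hb Hy x xD; have -> : x = H *m \col_j coord [tuple col j H | j < d] j x.
  rewrite [LHS](coord_basis Hb xD); apply/colP => i.
  rewrite summxE mxE; apply: eq_bigr => j _.
  by rewrite -tnth_nth tnth_mktuple !mxE mulrC.
by rewrite dotC dot_mulmx Hy dot0r.
Qed.

Theorem theorem21 (R : realType) (l n m : nat)
    (A : 'M[R]_(l, m)) (B : 'M[R]_(n, m))
    (T := mxKer (add_ones_row A)) (D := mxKer (add_ones_row B))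
    (Pbar := closed_coef_polytope A)
    (dP d nP : nat)
    (v : 'I_nP -> 'cV[R]_m) (G : 'M[R]_(m, dP)) (H : 'M[R]_(m, d))
    (C_neq0 : coef_cone A !=set0)
    (dim_P : has_dim (coef_polytope A) dP)
    (dim_D : \dim D = d)
    (dP_eq_d : dP = d)
    (v_inj : injective v)
    (v_vertices : range v = [set x | is_vertex Pbar x])
    (im_G : T = mxIm G)
    (G_orthonormal : G^T *m G = 1%:M)
    (H_basis : basis_of D [tuple col j H | j < d])
    (cond_i : sign_set (orthogonal_complement D) `&` sign_set [set` T]
              = [set 0])
    (cond_ii : forall f : set 'cV[R]_m,
       is_face Pbar f -> f !=set0 -> f <> Pbar ->
       ~ sign_set (orthogonal_complement D) (face_sign f)) :
  diffeomorphism [set: 'cV[R]_dP] (positive_orthant d) (Fmap v G H).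
Proof.
subst dP.
have P_neq0 : coef_polytope A !=set0 by case: dim_P => x Px _; exists x.
apply: (Fmap_diffeomorphism P_neq0 v_vertices)
  => [eta|//|y t Hy At t0 yt|f ff f0 fP y Hy yf].
- apply/mem_ker_ones; rewrite -[mxKer _]/T im_G; apply/mem_mxIm; by exists eta.
- apply: sign_vector_eq0.
  suff : [set 0] (sign_vector t) by [].
  rewrite -cond_i; split.
    by exists y => //; exact: orthogonal_complement_span Hy.
  by exists t => //=; apply/mem_ker_ones.
- apply: (cond_ii f ff f0 fP); exists y => //.
  exact: orthogonal_complement_span Hy.
Qed.
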